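(* Consider a tandem switched network with an arbitrary set of schedules $\mathcal S$ and the same mean work per job required at each queue. Then the MaxWeight policy, which, given the queue length vector $\mathbf Q$, uses a schedule maximizing $\sum_{j\in\mathcal J}Q_j\sigma_j$ over $\boldsymbol\sigma\in\mathcal S$, is maximally stable for this network: whenever the traffic intensity $\boldsymbol\rho$ lies in the interior $\mathcal C$ of the convex hull of $\mathcal S$, the associated queueing network process $(\mathbf Q(t):t\in\mathbb Z_+)$ is positive recurrent.
   Context: **Tandem switched network.** The queues are $\mathcal J=\{1,\dots,|\mathcal J|\}$ and time is discrete. All jobs enter the network at queue $1$. The numbers of external arrivals per time unit at queue $1$ are $\mathbb Z_+$-valued and i.i.d. with mean $a$; $E_1(t)$ is the total of the first $t$ of them, and $E_j\equiv0$ for $j\ge2$. Jobs completing service at queue $j<|\mathcal J|$ move to queue $j+1$, and jobs completing service at queue $|\mathcal J|$ leave. *Job sizes.* Job sizes at each queue are geometric with the same parameter $p\in(0,1]$: each unit of service devoted to a queue completes the job being served with probability $p$, independently. So the mean work per job is $1/p$ at every queue. $S_j(u)$ is the number of jobs completed by $u$ units of service at queue $j$. *Schedules.* $\mathcal S\subset\mathbb Z_+^{|\mathcal J|}$ is a finite set of feasible schedules such that $\boldsymbol\sigma\in\mathcal S$, $\boldsymbol\sigma'\in\mathbb Z_+^{|\mathcal J|}$ and $\boldsymbol\sigma'\le\boldsymbol\sigma$ coordinatewise imply $\boldsymbol\sigma'\in\mathcal S$. *Dynamics.* Let $\boldsymbol\pi(\mathbf Q)\in\mathcal S$ be the schedule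 chosen by the policy at queue length vector $\mathbf Q$ (ties broken arbitrarily or randomly, depending only on $\mathbf Q$). For $t\in\mathbb N$, $Q_j(t)=Q_j(0)+A_j(t)-D_j(t)$, with $A_1=E_1$, $A_j=D_{j-1}$ for $j\ge2$, $D_j(t)=S_j(\Pi_j(t))$, $\Pi_j(t)=\sum_{\tau=0}^{t-1}\big(\pi_j(\mathbf Q(\tau))\wedge Q_j(\tau)\big)$. $(\mathbf Q(t))$ is a discrete time countable state space Markov chain. *Traffic intensity.* $\rho_j=a/p$ for every $j$. *)

(* Defs.v *)
(* World: MathComp with MathComp-Analysis *)
From HB Require Import structures.
From mathcomp Require Import all_boot all_order all_algebra.
From mathcomp Require Import all_classical all_reals all_analysis.

Set Implicit Arguments.
Unset Strict Implicit.
Unset Printing Implicit Defensive.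

Import Order.TTheory GRing.Theory Num.Theory.
Import numFieldNormedType.Exports.

Local Open Scope classical_set_scope.
Local Open Scope ring_scope.

(* The queues 1, ..., n + 1 are the indices 0, ..., n of 'I_n.+1. Both queue
   length vectors and schedules are elements of [qvec n]. *)
Definition qvec (n : nat) := {ffun 'I_n.+1 -> nat}.

Section Schedules.
Variables (R : realType) (n : nat).

Definition schedule_closed (S : set (qvec n)) :=
  forall s s' : qvec n, S s -> (forall j, (s' j <= s j)%N) -> S s'.

Definition qvec_row (s : qvec n) : 'rV[R]_n.+1 := \row_j (s j)%:R.

Definition convex_hull (M : lmodType R) (A : set M) : set M :=
  smallest (@convex_set R M) A.

(* Interior with respect to the usual topology of R^(n+1). *)
Definition capacity_region (S : set (qvec n)) : set 'rV[R]_n.+1 :=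
  (convex_hull (qvec_row @` S))°.

Definition traffic_intensity (a p : R) : 'rV[R]_n.+1 := \row_j (a / p).

(* [policy q u] is the schedule used at the queue length vector [q]; [u] is
   the randomness used to break ties. *)
Definition maxweight (U : Type) (S : set (qvec n)) (policy : qvec n -> U -> qvec n) :=
  forall q u, S (policy q u) /\
    forall s, S s ->
      (\sum_j q j * s j <= \sum_j q j * policy q u j)%N.

End Schedules.

Section Probability.
Context d (Omega : measurableType d) (R : realType) (P : probability Omega R).

Definition identically_distributed d' (T : measurableType d')
    (X : nat -> {RV P >-> T}) :=
  forall t (B : set T), measurable B -> P (X t @^-1` B) = P (X 0%N @^-1` B).

Definition mutually_independent (I : eqType) (F : I -> set_system Omega) :=
  forall (s : seq I) (A : I -> set Omega), uniq s ->
    (forall i, i \in s -> F i (A i)) ->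
    fine (P (\bigcap_(i in [set` s]) A i)) = \prod_(i <- s) fine (P (A i)).

(* The sigma-algebras generated by the individual primitive variables: the
   arrivals of each time unit, the outcome of each unit of service at each
   queue, and the tie-breaking randomness of each time unit. *)
Definition primitive_sigma n d' (U : measurableType d')
    (arr : nat -> {RV P >-> nat}) (serv : 'I_n.+1 -> nat -> {RV P >-> bool})
    (seed : nat -> {RV P >-> U}) (i : nat + 'I_n.+1 * nat + nat) :
    set_system Omega :=
  match i with
  | inl (inl t) => preimage_set_system setT (arr t) measurable
  | inl (inr (j, v)) => preimage_set_system setT (serv j v) measurable
  | inr t => preimage_set_system setT (seed t) measurable
  end.

End Probability.

Section Dynamics.
Variables (n : nat) (Omega U : Type).
Variables (arr : nat -> Omega -> nat) (serv : 'I_n.+1 -> nat -> Omega -> bool).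
Variables (seed : nat -> Omega -> U) (policy : qvec n -> U -> qvec n).

Definition external_arrivals (j : 'I_n.+1) (t : nat) (w : Omega) : nat :=
  if j == ord0 then (\sum_(tau < t) arr tau w)%N else 0%N.

(* S_j(u): the v-th unit of service at queue j completes the job in service
   iff [serv j v] is true. *)
Definition completions (j : 'I_n.+1) (u : nat) (w : Omega) : nat :=
  (\sum_(v < u) serv j v w)%N.

Section Trajectory.
Variable Q : nat -> Omega -> qvec n.

Definition cum_service (j : 'I_n.+1) (t : nat) (w : Omega) : nat :=
  (\sum_(tau < t) minn (policy (Q tau w) (seed tau w) j) (Q tau w j))%N.

Definition departures (j : 'I_n.+1) (t : nat) (w : Omega) : nat :=
  completions j (cum_service j t w) w.

Definition arrivals (j : 'I_n.+1) (t : nat) (w : Omega) : nat :=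
  if j == ord0 then external_arrivals j t w
  else departures (inord j.-1) t w.

Definition queueing_process (x : qvec n) :=
  forall t w j,
    (Q t w j)%:Z = (x j)%:Z + (arrivals j t w)%:Z - (departures j t w)%:Z.

End Trajectory.
End Dynamics.

Section PositiveRecurrence.
Context d (Omega : measurableType d) (R : realType) (P : probability Omega R).
Variable T : Type.

(* First time at or after [t0] at which X is in A (+oo if there is none). *)
Definition entrance_time (t0 : nat) (X : nat -> Omega -> T) (A : set T)
    (w : Omega) : \bar R :=
  ereal_inf [set (t%:R)%:E | t in [set t | (t0 <= t)%N /\ A (X t w)]].

(* A Markov chain is given by its trajectories [X x] from each initial
   state [x]. *)
Definition positive_recurrent_state (X : T -> nat -> Omega -> T) (y : T) :=
  (\int[P]_w entrance_time 1 (X y) [set y] w < +oo)%E.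

(* The chain need not be irreducible (the arrivals may be deterministic and
   ties may be broken in any way), so transient states and several recurrent
   classes are allowed: from every initial state the mean time to reach the
   set of positive recurrent states is finite, and hence every recurrent state
   is positive recurrent. For an irreducible chain this says that all states
   are positive recurrent. *)
Definition positive_recurrent (X : T -> nat -> Omega -> T) :=
  forall x, (\int[P]_w
    entrance_time 0 (X x) [set y | positive_recurrent_state X y] w < +oo)%E.

End PositiveRecurrence.

(* Main.v *)
Require Import Defs.
From HB Require Import structures.
From mathcomp Require Import all_boot all_order all_algebra.
From mathcomp Require Import all_classical all_reals all_analysis.
From mathcomp Require Import measurable_realfun.
From mathcomp Require Import ring lra zify.
Set Implicit Arguments.
Unset Strict Implicit.
Unset Printing Implicit Defensive.
Import Order.TTheory GRing.Theory Num.Theory.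
Import numFieldNormedType.Exports.
Local Open Scope classical_set_scope.
Local Open Scope ring_scope.

(* A one-step Foster-Lyapunov argument. Write rho = a / p, z_s = s - rho for a
   schedule s, and (M z)_j = z_(j-1) - z_j with z_(-1) = 0. If s is the schedule
   effectively used, the mean increment of the queue lengths is p M z_s, and
   <z, M z> = - (1/2) (sum_j (z_j - z_(j-1))^2 + z_n^2) < 0 for z <> 0.
   The piecewise linear function max_s <z_s, q>, which is at least a positive
   multiple of the total queue length as rho lies in the interior of the convex
   hull, thus decreases where the maximizer is unique. At its kinks it has to
   be modified: for every set F of schedules whose z_s do not have 0 in their
   convex hull, Ville's theorem of the alternative provides a convex combination
   g_F, with positive weights, such that <g_F, M z_s> < 0 for all s in F at once.
   The potential is a softmax of the functions <g_F, q> + L_|F|, where L grows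
   so fast with |F| that F only matters at q when all nearly optimal schedules
   at q belong to F. It is Lipschitz and almost affine at the scale of one
   step, so that the mean of the arrivals has only to be finite.
   Since no irreducibility is assumed, the drift condition is combined with the
   existence, from every state, of a reachable closed class that meets the
   finite exceptional set. *)

(** * Countable partitions *)

Lemma pickle_fiberE (Omega : Type) (H : countType) (c : Omega -> H) (k : nat) :
  [set w | pickle (c w) = k] =
  if pickle_inv k is Some h then [set w | c w = h] else set0.
Proof.
case E : (pickle_inv k : option H) => [h|].
  apply/seteqP; split => w /=.
    by move=> Ek; move: E; rewrite -Ek pickleK_inv => -[].
  by move=> ->; have := @pickle_invK H k; rewrite /ocancel E.
by apply/seteqP; split => w //= Ek; move: E; rewrite -Ek pickleK_inv.
Qed.

Section Fibers.
Context d (Omega : measurableType d) (R : realType).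
Variable mu : {measure set Omega -> \bar R}.
Variables (H : countType) (c : Omega -> H).
Hypothesis mc : forall h, measurable [set w | c w = h].

Let fiber (k : nat) : set Omega := [set w | pickle (c w) = k].

Let fiber_measurable k : measurable (fiber k).
Proof.
by rewrite /fiber pickle_fiberE; case: pickle_inv => [h|].
Qed.

Lemma saturated_measurable (G : set Omega) :
  (forall w w', c w = c w' -> G w -> G w') -> measurable G.
Proof.
move=> satG.
rewrite (_ : G = \bigcup_(k in [set k | exists2 w, G w & pickle (c w) = k]) fiber k).
  by apply: bigcup_measurable => k _; exact: fiber_measurable.
apply/seteqP; split => w.
  by move=> Gw; exists (pickle (c w)) => //; exists w.
move=> [k [w' Gw' <-]] /= E.
by apply: satG Gw'; apply: (pcan_inj pickleK).
Qed.

Lemma saturated_measurable_fun (F : Omega -> \bar R) :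
  (forall w w', c w = c w' -> F w = F w') -> measurable_fun [set: Omega] F.
Proof.
move=> satF _ B mB; rewrite setTI; apply: saturated_measurable => w w' cww'.
by rewrite /preimage /= (satF _ _ cww').
Qed.

Lemma ge0_integral_fibers (D : set Omega) (F : Omega -> \bar R) :
  measurable D -> measurable_fun D F -> (forall w, D w -> 0 <= F w)%E ->
  (\int[mu]_(w in D) F w =
   \sum_(k <oo) \int[mu]_(w in D `&` fiber k) F w)%E.
Proof.
move=> mD mF F0.
have DE : D = \bigcup_k (D `&` fiber k).
  by apply/seteqP; split => [w Dw|w [k _ []] //]; exists (pickle (c w)).
rewrite [in LHS]DE ge0_integral_bigcup //.
- by move=> k; apply: measurableI => //; exact: fiber_measurable.
- by rewrite -DE.
- by rewrite -DE.
- by apply/trivIsetP => i j _ _ /eqP ij; apply/seteqP; split => w //= [[_ Ei] [_ Ej]]; case: ij; rewrite -Ei.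
Qed.

Lemma eq_integral_fibers (G : set Omega) (F1 F2 : Omega -> \bar R) :
  measurable G -> measurable_fun G F1 -> measurable_fun G F2 ->
  (forall w, G w -> 0 <= F1 w)%E -> (forall w, G w -> 0 <= F2 w)%E ->
  (forall h, (\int[mu]_(w in G `&` [set w | c w = h]) F1 w =
              \int[mu]_(w in G `&` [set w | c w = h]) F2 w)%E) ->
  (\int[mu]_(w in G) F1 w = \int[mu]_(w in G) F2 w)%E.
Proof.
move=> mG mF1 mF2 F10 F20 F12.
rewrite !ge0_integral_fibers //; apply: eq_eseriesr => k _.
rewrite /fiber pickle_fiberE; case: pickle_inv => [h //|].
by rewrite setI0 !integral_set0.
Qed.

End Fibers.

Lemma entrance_time_series d (Omega : measurableType d) (R : realType) T
    (t0 : nat) (Y : nat -> Omega -> T) (A : set T) (w : Omega) :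
  (entrance_time R t0 Y A w = \sum_(0 <= t <oo)
    (\1_([set w | forall i, (t0 <= i < t.+1)%N -> ~ A (Y i w)]) w)%:E)%E.
Proof.
rewrite /entrance_time.
have [hit|nohit] := pselect (exists t, (t0 <= t)%N && `[< A (Y t w) >]).
- case: (ex_minnP hit) => m /andP[t0m /asboolP Am] min_m.
  transitivity ((m%:R)%:E : \bar R).
    apply/eqP; rewrite eq_le; apply/andP; split.
      by apply: ereal_inf_lbound; exists m.
    apply: le_ereal_inf_tmp => _ /= [t [t0t At] <-].
    by rewrite lee_fin ler_nat min_m // t0t; apply/asboolP.
  rewrite (@nneseries_split _ _ 0 m); last by move=> k _; rewrite lee_fin.
  rewrite add0n [X in (_ = _ + X)%E]eseries0 ?adde0; last first.
    move=> k mk _; rewrite indicE memNset //= => /(_ m); apply => //.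
    by rewrite t0m ltnS mk.
  rewrite big_mkord (eq_bigr (fun=> 1%E)); last first.
    move=> i _; rewrite indicE mem_set //= => k /andP[t0k ki] Ak.
    have /min_m : (t0 <= k)%N && `[< A (Y k w) >] by rewrite t0k; apply/asboolP.
    by rewrite leqNgt => /negP; apply; rewrite (leq_ltn_trans _ (ltn_ord i)).
  by rewrite sumEFin sumr_const card_ord.
- rewrite (_ : [set _ | _ in _] = set0) ?ereal_inf0; last first.
    apply/seteqP; split => // _ /= [t [t0t At] _]; apply: nohit; exists t.
    by rewrite t0t; apply/asboolP.
  apply/esym/eqyP => r r0.
  have nr : (r <= (Num.bound r)%:R) by rewrite ltW // archi_boundP // ltW.
  rewrite (@le_trans _ _ ((Num.bound r)%:R)%:E) ?lee_fin //.
  apply: le_trans (nneseries_lim_ge (Num.bound r) _); last first.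
    by move=> k _ _; rewrite lee_fin.
  rewrite big_mkord (eq_bigr (fun=> 1%E)); last first.
    move=> i _; rewrite indicE mem_set //= => k /andP[t0k ki] Ak.
    by apply: nohit; exists k; rewrite t0k; apply/asboolP.
  by rewrite sumEFin sumr_const card_ord.
Qed.

(** * Foster's criterion without irreducibility *)

Section Chain.
Context d (Omega : measurableType d) (R : realType) (P : probability Omega R).
Variables (T : countType) (X : T -> nat -> Omega -> T).

Definition past_event (x : T) (t : nat) (G : set Omega) :=
  forall w w', (forall i, (i <= t)%N -> X x i w = X x i w') -> G w -> G w'.

Definition transition (f : T -> \bar R) (y : T) : \bar R :=
  (\int[P]_w f (X y 1%N w))%E.

Definition markov_chain :=
  [/\ forall x w, X x 0%N w = x,
      forall x t G, past_event x t G -> measurable G &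
      forall x t G f, past_event x t G -> (forall y, 0 <= f y)%E ->
        (\int[P]_(w in G) f (X x t.+1 w) =
         \int[P]_(w in G) transition f (X x t w))%E].

Hypothesis chainX : markov_chain.

Let X0 x w : X x 0%N w = x. Proof. by case: chainX. Qed.

Lemma past_event_measurable x t G : past_event x t G -> measurable G.
Proof. by case: chainX => _ + _; exact. Qed.

Lemma chain_measurable_fun x t (f : T -> \bar R) (D : set Omega) :
  measurable_fun D (fun w => f (X x t w)).
Proof.
apply: measurable_funTS => _ B mB; rewrite setTI.
by apply: (@past_event_measurable x t) => w w' /(_ t (leqnn t)); rewrite /preimage /= => ->.
Qed.

Lemma transition_ge0 f y : (forall y, 0 <= f y)%E -> (0 <= transition f y)%E.
Proof. by move=> f0; exact: integral_ge0. Qed.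

Lemma le_transition f g y : (forall y, 0 <= f y)%E -> (forall y, f y <= g y)%E ->
  (transition f y <= transition g y)%E.
Proof.
move=> f0 fg; apply: ge0_le_integral => //; exact: chain_measurable_fun.
Qed.

Lemma transitionD f g y : (forall y, 0 <= f y)%E -> (forall y, 0 <= g y)%E ->
  transition (fun z => f z + g z)%E y = (transition f y + transition g y)%E.
Proof.
move=> f0 g0; rewrite /transition ge0_integralD //; exact: chain_measurable_fun.
Qed.

Lemma transitionZ (c : R) f y : (0 <= c)%R -> (forall y, 0 <= f y)%E ->
  transition (fun z => c%:E * f z)%E y = (c%:E * transition f y)%E.
Proof.
move=> c0 f0; rewrite /transition ge0_integralZl //; exact: chain_measurable_fun.
Qed.

Lemma transition_cst (c : R) y : transition (fun=> c%:E) y = c%:E.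
Proof.
rewrite /transition (integral_cst P measurableT) -[RHS]mule1.
by congr (_ * _)%E; exact: probability_setT.
Qed.

Lemma transition_sum (I : Type) (r : seq I) (f : I -> T -> \bar R) y :
  (forall i y, 0 <= f i y)%E ->
  transition (fun z => \sum_(i <- r) f i z)%E y = (\sum_(i <- r) transition (f i) y)%E.
Proof.
move=> f0; rewrite /transition ge0_integral_sum // => i; exact: chain_measurable_fun.
Qed.

Section Foster.
Variables (x : T) (t0 : nat) (A : set T) (f : T -> \bar R) (delta : R).
Hypothesis delta_gt0 : 0 < delta.
Hypothesis f_ge0 : forall y, (0 <= f y)%E.
Hypothesis drift : forall y, ~ A y -> (transition f y + delta%:E <= f y)%E.

Let avoid t : set Omega := [set w | forall i, (t0 <= i < t)%N -> ~ A (X x i w)].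

Let avoid_past t : past_event x t (avoid t.+1).
Proof.
move=> w w' ww' Gw i /andP[t0i it]; rewrite -ww' //.
by apply: Gw; rewrite t0i.
Qed.

Let avoid_measurable t : measurable (avoid t).
Proof.
apply: (@past_event_measurable x t) => w w' ww' Gw i /andP[t0i it].
by rewrite -ww' ?(ltnW it) //; apply: Gw; rewrite t0i.
Qed.

Let avoid_step t : (t0 <= t)%N ->
  (delta%:E * P (avoid t.+1) + \int[P]_(w in avoid t.+1) f (X x t.+1 w) <=
   \int[P]_(w in avoid t) f (X x t w))%E.
Proof.
move=> t0t.
have [_ _ markovX] := chainX.
rewrite (markovX _ _ _ _ (@avoid_past t)) //.
have avoidS : avoid t.+1 `<=` avoid t.
  move=> w Gw i /andP[t0i it]; apply: Gw.
  by rewrite t0i ltnS ltnW.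
apply: (@le_trans _ _ (\int[P]_(w in avoid t.+1) f (X x t w))%E); last first.
  by apply: ge0_subset_integral => //; exact: chain_measurable_fun.
rewrite -(integral_cst P (avoid_measurable t.+1)) -ge0_integralD //=.
- apply: ge0_le_integral => //.
  + by move=> w _; rewrite adde_ge0 ?transition_ge0 // lee_fin ltW.
  + apply: emeasurable_funD => //; exact: chain_measurable_fun.
  + exact: chain_measurable_fun.
  + move=> w Gw; rewrite addeC; apply: drift; apply: Gw.
    by rewrite t0t ltnSn.
- by move=> w _; rewrite lee_fin ltW.
- by move=> w _; exact: transition_ge0.
- exact: chain_measurable_fun.
Qed.

Let avoid_sum m :
  (\sum_(0 <= t < t0 + m) (delta%:E * P (avoid t.+1)) +
   \int[P]_(w in avoid (t0 + m)) f (X x (t0 + m) w) <=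
   (t0%:R * delta)%:E + \int[P]_w f (X x t0 w))%E.
Proof.
elim: m => [|m IHm].
  rewrite addn0 leeD //.
    rewrite big_mkord (@le_trans _ _ (\sum_(i < t0) delta%:E)%E) //.
      apply: lee_sum => i _; rewrite -[leRHS]mule1 lee_wpmul2l ?lee_fin ?(ltW delta_gt0) //.
      exact: probability_le1.
    by rewrite sumEFin sumr_const card_ord mulr_natl.
  by apply: ge0_subset_integral => //; exact: chain_measurable_fun.
apply: le_trans IHm.
rewrite addnS big_nat_recr //= -addeA leeD //; apply: avoid_step.
by rewrite leq_addr.
Qed.

Lemma foster_entrance_lty : (\int[P]_w f (X x t0 w) < +oo)%E ->
  (\int[P]_w entrance_time R t0 (X x) A w < +oo)%E.
Proof.
move=> fin_start.
under eq_integral do rewrite entrance_time_series.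
rewrite integral_nneseries //; last first.
- move=> t; apply/measurable_EFinP; apply: measurable_indic.
  exact: avoid_measurable.
have avoidE t : (\int[P]_w (\1_(avoid t.+1) w)%:E = P (avoid t.+1))%E.
  by rewrite integral_indic ?setIT.
rewrite (eq_eseriesr (fun t _ => avoidE t)).
pose C := ((t0%:R * delta)%:E + \int[P]_w f (X x t0 w))%E.
have C_fin : (C < +oo)%E by rewrite lte_add_pinfty // ltry.
suff : (delta%:E * (\sum_(0 <= t <oo) P (avoid t.+1)) <= C)%E.
  move=> dC; rewrite ltey; apply/eqP => E; move: dC; rewrite E gt0_muley ?lte_fin //.
  by rewrite leye_eq => /eqP CE; rewrite CE in C_fin.
rewrite -nneseriesZl //; apply: lime_le.
  by apply: is_cvg_nneseries => t _ _; rewrite mule_ge0 // lee_fin ltW.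
near=> m.
have t0m : (t0 <= m)%N by near: m; exists t0.
have := avoid_sum (m - t0); rewrite subnKC //; apply: le_trans.
by rewrite leeDl //; apply: integral_ge0.
Unshelve. all: by end_near. Qed.

End Foster.

Definition one_step (y z : T) := (0 < P [set w | X y 1%N w = z])%E.

Inductive reachable (y : T) : T -> Prop :=
| reachable_refl : reachable y y
| reachable_step z z' : reachable y z -> one_step z z' -> reachable y z'.

Lemma reachable_trans x y z : reachable x y -> reachable y z -> reachable x z.
Proof. by move=> xy; elim=> // z1 z2 _; exact: reachable_step. Qed.

Let state_measurable y z : measurable [set w | X y 1%N w = z].
Proof.
by apply: (@past_event_measurable y 1) => w w' /(_ 1%N isT) /= ->.
Qed.

Lemma leave_closed_null y (Z : set T) : Z y ->
  (forall z, one_step y z -> Z z) -> P [set w | ~ Z (X y 1%N w)] = 0%E.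
Proof.
move=> Zy closedZ.
have mZ : measurable [set w | ~ Z (X y 1%N w)].
  by apply: (@past_event_measurable y 1) => w w' /(_ 1%N isT) /= ->.
have cst1 (B : set Omega) : measurable B -> (\int[P]_(w in B) cst 1 w = P B)%E.
  by move=> mB; rewrite (integral_cst P mB) mul1e.
rewrite -(cst1 _ mZ) -(integral0 P [set w | ~ Z (X y 1%N w)]).
apply: (eq_integral_fibers (state_measurable y)) => // z.
have mI : measurable ([set w | ~ Z (X y 1%N w)] `&` [set w | X y 1%N w = z]).
  by apply: measurableI => //; exact: state_measurable.
rewrite cst1 // integral0.
have [Zz|nZz] := pselect (Z z).
  rewrite (_ : _ `&` _ = set0) ?measure0 //.
  by apply/seteqP; split => // w [/= + E]; rewrite E.
apply/eqP; rewrite -measure_le0.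
apply: (@le_trans _ _ (P [set w | X y 1%N w = z])).
  by apply: le_measure; rewrite ?inE //; exact: state_measurable.
by rewrite leNgt; apply/negP => /closedZ.
Qed.

Fixpoint hit_prob (A : set T) (k : nat) (y : T) : \bar R :=
  if k is k'.+1 then (if `[< A y >] then 1 else transition (hit_prob A k') y)%E
  else (\1_A y)%:E.

Lemma hit_prob_ge0 A k y : (0 <= hit_prob A k y)%E.
Proof.
elim: k y => [|k IHk] y /=; first by rewrite lee_fin.
by case: asboolP => // _; exact: transition_ge0.
Qed.

Lemma hit_prob_le1 A k y : (hit_prob A k y <= 1)%E.
Proof.
elim: k y => [|k IHk] y /=; first by rewrite lee_fin indicE; case: (_ \in _).
case: asboolP => // _; rewrite -(transition_cst 1 y).
by apply: le_transition => // z; exact: hit_prob_ge0.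
Qed.

Lemma hit_prob_fin A k y : hit_prob A k y \is a fin_num.
Proof.
by rewrite fin_numE -ltNye -ltey (lt_le_trans _ (hit_prob_ge0 _ _ _)) //
  (le_lt_trans (hit_prob_le1 _ _ _)) ?ltry.
Qed.

Lemma hit_prob_ndS A k y : (hit_prob A k y <= hit_prob A k.+1 y)%E.
Proof.
elim: k y => [|k IHk] y.
  rewrite /= indicE; case: asboolP => [Ay|nAy]; first by rewrite mem_set.
  by rewrite memNset // transition_ge0 // => z; rewrite lee_fin.
rewrite [leRHS]/= [leLHS]/=; case: asboolP => // _.
by apply: le_transition => // z; exact: hit_prob_ge0.
Qed.

Lemma hit_prob_nd A k l y : (k <= l)%N -> (hit_prob A k y <= hit_prob A l y)%E.
Proof.
move=> /subnKC <-; elim: (l - k)%N => [|m IHm]; first by rewrite addn0.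
by rewrite addnS (le_trans IHm) // hit_prob_ndS.
Qed.

Lemma one_step_hit_prob A k y z : one_step y z -> (0 < hit_prob A k z)%E ->
  (0 < hit_prob A k.+1 y)%E.
Proof.
move=> yz hz /=; case: asboolP => // nAy.
apply: (@lt_le_trans _ _
  (\int[P]_(w in [set w | X y 1%N w = z]) hit_prob A k (X y 1%N w))%E).
  rewrite (eq_integral (cst (hit_prob A k z))); last first.
    by move=> w; rewrite inE /= => ->.
  by rewrite (integral_cst P (state_measurable y z)) mule_gt0.
apply: ge0_subset_integral => //; first exact: chain_measurable_fun.
by move=> w _; exact: hit_prob_ge0.
Qed.

Lemma reachable_hit_prob (A : set T) y z : reachable y z -> A z ->
  exists k, (0 < hit_prob A k y)%E.
Proof.
move=> yz Az; have : exists k, (0 < hit_prob A k z)%E.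
  by exists 0%N; rewrite /= indicE mem_set // lte_fin.
elim: yz {Az} => // z1 z2 _ IH z12 [k hk]; apply: IH.
by exists k.+1; exact: one_step_hit_prob hk.
Qed.

Section Hitting.
Variables (V : T -> R) (C : seq T) (delta : R).
Hypothesis delta_gt0 : 0 < delta.
Hypothesis V_ge0 : forall y, 0 <= V y.
Hypothesis V_fin : forall y, (transition (EFin \o V) y < +oo)%E.
Hypothesis V_drift : forall y, y \notin C ->
  (transition (EFin \o V) y + delta%:E <= (V y)%:E)%E.

Let KV y := fine (transition (EFin \o V) y).

Let KVE y : transition (EFin \o V) y = (KV y)%:E.
Proof.
rewrite /KV fineK // fin_numE -ltNye -ltey V_fin andbT.
by apply: lt_le_trans (transition_ge0 _ _) => // z; rewrite lee_fin.
Qed.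

Section Corrected.
Variables (A Z : set T).
Hypothesis Z_closed : forall y z, Z y -> one_step y z -> Z z.
Hypothesis A_hit : forall y, y \in C -> Z y -> exists k, (0 < hit_prob A k y)%E.

Let hp k y := fine (hit_prob A k y).
Let hpE k y : (hp k y)%:E = hit_prob A k y.
Proof. by rewrite /hp fineK // hit_prob_fin. Qed.
Let hp_ge0 k y : 0 <= hp k y.
Proof. by rewrite -lee_fin hpE hit_prob_ge0. Qed.
Let hp_le1 k y : hp k y <= 1.
Proof. by rewrite -lee_fin hpE hit_prob_le1. Qed.

Let uniform_hit : exists N, forall y, y \in C -> Z y -> 0 < hp N y.
Proof.
elim: C A_hit => [|x s IHs] hit; first by exists 0%N.
have [N HN] := IHs (fun y ys => hit y (mem_behead (s := x :: s) ys)).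
have [Zx|nZx] := pselect (Z x); last first.
  by exists N => y; rewrite inE => /predU1P[->|ys] // Zy; exact: HN.
have [k hk] := hit x (mem_head _ _) Zx.
exists (maxn N k) => y; rewrite inE -lte_fin hpE => /predU1P[->|ys] Zy.
  by apply: lt_le_trans hk _; apply: hit_prob_nd; rewrite leq_maxr.
have := HN y ys Zy; rewrite -lte_fin hpE => h.
by apply: lt_le_trans h _; apply: hit_prob_nd; rewrite leq_maxl.
Qed.

(* [V] alone fails to decrease on [C]; subtracting a large multiple of the
   bounded function [sum_(k < N) hit_prob A k] repairs this, since the
   transition operator increases it by [hit_prob A N] outside of [A]. *)
Lemma hitting_lyapunov : exists f : T -> \bar R,
  [/\ forall y, (0 <= f y)%E,
      forall y, ~ A y -> (transition f y + delta%:E <= f y)%E &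
      forall y, Z y -> (f y < +oo)%E /\ (transition f y < +oo)%E].
Proof.
have [N HN] := uniform_hit.
pose Psi y := \sum_(k < N) hp k y.
have Psi_le y : Psi y <= N%:R.
  rewrite -[N in leRHS]card_ord -sumr_const; exact: ler_sum.
have Psi_ge0 y : 0 <= Psi y by exact: sumr_ge0.
pose c := \sum_(y <- C) `|KV y + delta - V y| / hp N y.
have c_ge0 : 0 <= c.
  by rewrite /c; elim: C => [|y s IHs]; rewrite ?big_nil // big_cons addr_ge0 // divr_ge0.
have c_large y : y \in C -> Z y -> KV y + delta - V y <= c * hp N y.
  move=> yC Zy; have hNy := HN y yC Zy.
  rewrite -ler_pdivrMr // (le_trans (y := `|KV y + delta - V y| / hp N y)) //.
    by rewrite ler_pM2r ?invr_gt0 // ler_norm.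
  rewrite /c (big_rem y) //= lerDl.
  by elim: (rem y C) => [|z s IHs]; rewrite ?big_nil // big_cons addr_ge0 // divr_ge0.
pose f0 y := V y + c * (N%:R - Psi y).
have f0_ge0 y : 0 <= f0 y by rewrite addr_ge0 // mulr_ge0 // subr_ge0.
have eV_ge0 y : (0 <= (EFin \o V) y)%E by rewrite lee_fin.
have Kf0 y : (transition (EFin \o f0) y + c%:E * transition (EFin \o Psi) y =
    (KV y + c * N%:R)%:E)%E.
  rewrite -transitionZ //.
  rewrite -transitionD //; last by move=> z; rewrite mule_ge0 // lee_fin.
  rewrite EFinD -KVE -(transition_cst (c * N%:R) y) -transitionD //; last first.
    by move=> z; rewrite lee_fin mulr_ge0.
  rewrite /transition; apply: eq_integral => w _ /=.
  by rewrite -EFinM -!EFinD /f0; congr (_%:E); ring.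
have KPsi y : ~ A y -> transition (EFin \o Psi) y = (Psi y + hp N y)%:E.
  move=> nAy.
  have -> : EFin \o Psi = (fun z => \sum_(k < N) hit_prob A k z)%E.
    by apply/funext => z; rewrite /= /Psi -sumEFin; apply: eq_bigr => k _; rewrite hpE.
  rewrite transition_sum; last by move=> k z; exact: hit_prob_ge0.
  have hpS k : transition (hit_prob A k) y = (hp k.+1 y)%:E.
    by rewrite hpE /=; case: asboolP.
  under eq_bigr do rewrite hpS.
  rewrite sumEFin; congr (_%:E); rewrite /Psi.
  have hp0 : hp 0 y = 0 by rewrite /hp /= indicE memNset.
  transitivity (\sum_(k < N.+1) hp k y).
    by rewrite big_ord_recl hp0 add0r.
  by rewrite big_ord_recr.
have Kf0_lty y : (transition (EFin \o f0) y < +oo)%E.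
  apply: le_lt_trans (ltry (KV y + c * N%:R)); rewrite -Kf0 leeDl //.
  by rewrite mule_ge0 ?lee_fin // transition_ge0 // => z; rewrite lee_fin.
have f0_drift y : ~ A y -> Z y -> (transition (EFin \o f0) y + delta%:E <= (f0 y)%:E)%E.
  move=> nAy Zy; have := Kf0 y; rewrite KPsi //.
  have : transition (EFin \o f0) y \is a fin_num.
    rewrite fin_numE -ltNye -ltey Kf0_lty andbT.
    by apply: lt_le_trans (transition_ge0 _ _) => // z; rewrite lee_fin.
  case: (transition _ y) => // k _ [] kE; rewrite -EFinD lee_fin /f0.
  suff : KV y + delta - V y <= c * hp N y by lra.
  have [yC|yC] := boolP (y \in C); first exact: c_large.
  have := V_drift yC; rewrite KVE -EFinD lee_fin => h.
  by rewrite (le_trans (y := 0)) ?mulr_ge0 //; lra.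
pose f y := if `[< Z y >] then (f0 y)%:E else +oo%E.
have f_ge0 y : (0 <= f y)%E by rewrite /f; case: asboolP => // _; rewrite lee_fin.
have Kf y : Z y -> transition f y = transition (EFin \o f0) y.
  move=> Zy; apply: ge0_ae_eq_integral => //.
  - exact: (chain_measurable_fun y 1 f).
  - exact: (chain_measurable_fun y 1 (EFin \o f0)).
  - by move=> w _; rewrite lee_fin.
  - exists [set w | ~ Z (X y 1%N w)]; split.
    + by apply: (@past_event_measurable y 1) => w w' /(_ 1%N isT) /= ->.
    + apply: (leave_closed_null Zy) => z; exact: Z_closed.
    + by move=> w /= + Zw; apply=> _; rewrite /f; case: asboolP.
exists f; split=> // y.
- move=> nAy; rewrite /f; case: asboolP => [Zy|_]; last exact: leey.
  by rewrite -/f Kf // f0_drift.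
- by move=> Zy; rewrite Kf // /f; case: asboolP => // _; rewrite ltry Kf0_lty.
Qed.

End Corrected.

Let essential (y : T) := forall z, z \in C -> reachable y z -> reachable z y.

Let reach_essential x : x \in C -> exists y, [/\ y \in C, reachable x y & essential y].
Proof.
pose cnt y := count (fun z => `[< reachable y z >]) C.
have [m] := ubnP (cnt x); elim: m x => // m IHm x; rewrite ltnS => cx xC.
have [ex|nex] := pselect (essential x).
  by exists x; split => //; exact: reachable_refl.
have [z [zC xz nzx]] : exists z, [/\ z \in C, reachable x z & ~ reachable z x].
  apply: contrapT => H; apply: nex => z zC xz; apply: contrapT => nzx.
  by apply: H; exists z.
have [|y [yC zy ey]] := IHm z _ zC.
  apply: leq_trans cx; rewrite /cnt.
  have sub : subpred (fun u => `[< reachable z u >]) (fun u => `[< reachable x u >]).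
    by move=> u /asboolP zu; apply/asboolP; exact: reachable_trans zu.
  elim: C xC => // u s IHs; rewrite inE => /predU1P[<-|xs] /=.
    rewrite (asboolF nzx) asboolT ?add0n ?add1n ?ltnS ?sub_count //.
    exact: reachable_refl.
  rewrite -addnS leq_add //; last exact: IHs.
  by case: (boolP `[< reachable z u >]) => // /sub ->.
by exists y; split => //; exact: reachable_trans zy.
Qed.

Theorem foster_positive_recurrent : positive_recurrent P X.
Proof.
have f_start f x : (\int[P]_w f (X x 0%N w) = f x :> \bar R)%E.
  under eq_integral do rewrite X0.
  rewrite (integral_cst P measurableT) -[RHS]mule1.
  by congr (_ * _)%E; exact: probability_setT.
have essential_recurrent y : y \in C -> essential y -> positive_recurrent_state P X y.
  move=> yC ey.
  have [f [f0 fd fZ]] : exists f : T -> \bar R,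
    [/\ forall z, (0 <= f z)%E,
      forall z, ~ [set y] z -> (transition f z + delta%:E <= f z)%E &
      forall z, reachable y z -> (f z < +oo)%E /\ (transition f z < +oo)%E].
    apply: (@hitting_lyapunov [set y] (reachable y)).
    - by move=> z z' yz zz'; exact: reachable_step zz'.
    - by move=> z zC yz; apply: (@reachable_hit_prob _ z y) => //; exact: ey.
  apply: (foster_entrance_lty delta_gt0 f0 fd).
  by case: (fZ y (reachable_refl y)).
move=> x.
have [f [f0 fd fZ]] : exists f : T -> \bar R,
  [/\ forall z, (0 <= f z)%E,
    forall z, ~ [set y | positive_recurrent_state P X y] z ->
      (transition f z + delta%:E <= f z)%E &
    forall z, setT z -> (f z < +oo)%E /\ (transition f z < +oo)%E].
  apply: hitting_lyapunov => // z zC _.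
  have [y [yC zy ey]] := reach_essential zC.
  by apply: reachable_hit_prob zy _; exact: essential_recurrent.
apply: (foster_entrance_lty delta_gt0 f0 fd).
by rewrite f_start; case: (fZ x I).
Qed.

End Hitting.

End Chain.

Lemma ge0_integral_independent d (Omega : measurableType d) (R : realType)
    (P : probability Omega R) (H : countType) (c1 c2 : Omega -> H)
    (D : set Omega) (g : H -> \bar R) :
  (forall h, measurable [set w | c1 w = h]) ->
  (forall h, measurable [set w | c2 w = h]) -> measurable D ->
  (forall h, P (D `&` [set w | c1 w = h]) = P D * P [set w | c2 w = h])%E ->
  (forall h, 0 <= g h)%E ->
  (\int[P]_(w in D) g (c1 w) = P D * \int[P]_w g (c2 w))%E.
Proof.
move=> mc1 mc2 mD law g0.
have mg c : (forall h, measurable [set w | c w = h]) ->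
    measurable_fun [set: Omega] (fun w => g (c w) : \bar R).
  by move=> mc; apply: (saturated_measurable_fun mc) => w w' ->.
rewrite (ge0_integral_fibers P mc1) //; last by apply: measurable_funTS; exact: mg.
rewrite (ge0_integral_fibers P mc2) //; last exact: mg.
have PDE : P D = (fine (P D))%:E by rewrite fineK // fin_num_measure.
rewrite PDE -nneseriesZl; last by move=> k _; apply: integral_ge0.
apply: eq_eseriesr => k _; rewrite -PDE setTI.
rewrite !pickle_fiberE; case: pickle_inv => [h|]; last first.
  by rewrite setI0 !integral_set0 mule0.
rewrite (eq_integral (cst (g h))); last by move=> w; rewrite inE => -[_ /= ->].
rewrite [in RHS](eq_integral (cst (g h))); last by move=> w; rewrite inE => /= ->.
have mDh : measurable (D `&` [set w | c1 w = h]) by exact: measurableI.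
rewrite (integral_cst P mDh) (integral_cst P (mc2 h)).
by rewrite [X in (_ * X)%E]law muleCA.
Qed.

(** * The Markov property of the queueing process *)

Lemma count_mkseq (f : nat -> bool) k : count id (mkseq f k) = (\sum_(i < k) f i)%N.
Proof.
elim: k => [|k IHk]; first by rewrite big_ord0.
by rewrite mkseqS -cats1 count_cat IHk big_ord_recr /= addn0.
Qed.

Section QueueDynamics.
Variables (n : nat) (Omega U : Type).
Variables (arr : nat -> Omega -> nat) (serv : 'I_n.+1 -> nat -> Omega -> bool).
Variables (seed : nat -> Omega -> U) (policy : qvec n -> U -> qvec n).

(* The arrivals, the schedule, and the outcomes of the units of service used
   at each queue during one time unit. *)
Definition outcome : countType := (nat * qvec n * {ffun 'I_n.+1 -> seq bool})%type.

Definition next (y : qvec n) (o : outcome) : qvec n :=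
  [ffun j => (y j + (if j == ord0 then o.1.1 else count id (o.2 (inord j.-1)))
              - count id (o.2 j))%N].

Definition step_outcome (y : qvec n) (t : nat) (m : 'I_n.+1 -> nat) (w : Omega) : outcome :=
  (arr t w, policy y (seed t w),
   [ffun j => mkseq (fun i => serv j (m j + i) w) (minn (policy y (seed t w) j) (y j))]).

Section Path.
Variables (Q : nat -> Omega -> qvec n) (x : qvec n).
Hypothesis Qx : queueing_process arr serv seed policy Q x.

Let cum t w j := cum_service seed policy Q j t w.

Definition path_outcome t w := step_outcome (Q t w) t (cum t w) w.

Lemma queueing_process0 w : Q 0 w = x.
Proof.
suff E (j : 'I_n.+1) : Q 0%N w j = x j by apply/ffunP.
have := Qx 0 w j.
have dep0 i : departures serv seed policy Q i 0 w = 0%N.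
  by rewrite /departures /cum_service big_ord0 /completions big_ord0.
rewrite /arrivals /external_arrivals big_ord0 !dep0.
case: eqP => _; move: (Q 0%N w j) (x j) => q y; lia.
Qed.

Lemma cum_serviceS t w j :
  cum t.+1 w j = (cum t w j + minn (policy (Q t w) (seed t w) j) (Q t w j))%N.
Proof. by rewrite /cum /cum_service big_ord_recr. Qed.

Lemma departuresS t w j : departures serv seed policy Q j t.+1 w =
  (departures serv seed policy Q j t w + count id ((path_outcome t w).2 j))%N.
Proof.
rewrite /departures -/(cum _ _ _) -/(cum t.+1 w j) cum_serviceS ffunE count_mkseq.
by rewrite /completions big_split_ord.
Qed.

Lemma queueing_processS t w : Q t.+1 w = next (Q t w) (path_outcome t w).
Proof.
suff E (j : 'I_n.+1) : Q t.+1 w j = next (Q t w) (path_outcome t w) j by apply/ffunP.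
rewrite ffunE; have := Qx t.+1 w j; have := Qx t w j.
rewrite departuresS.
have : (count id ((path_outcome t w).2 j) <= Q t w j)%N.
  rewrite ffunE (leq_trans (count_size _ _)) // size_mkseq geq_minr //.
rewrite /arrivals /external_arrivals; case: eqP => _.
  rewrite big_ord_recr /=; lia.
rewrite departuresS; lia.
Qed.

Definition path_code t w : seq outcome := mkseq (fun i => path_outcome i w) t.

Lemma path_codeP t w w' : path_code t w = path_code t w' ->
  (forall i, (i <= t)%N -> Q i w = Q i w') /\ (forall j, cum t w j = cum t w' j).
Proof.
elim: t => [|t IHt] E.
  split=> [i|j]; last by rewrite /cum /cum_service !big_ord0.
  by rewrite leqn0 => /eqP ->; rewrite !queueing_process0.
move: E; rewrite /path_code !mkseqS => /rcons_inj E.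
have [Qeq cumeq] := IHt (congr1 fst E).
have oE : path_outcome t w = path_outcome t w' := congr1 snd E.
split=> [i|j].
  rewrite leq_eqVlt => /predU1P[->|]; last by rewrite ltnS => /Qeq.
  by rewrite !queueing_processS Qeq // oE.
rewrite !cum_serviceS cumeq.
have -> : policy (Q t w) (seed t w) = policy (Q t w') (seed t w').
  by have := congr1 (fun o : outcome => o.1.2) oE.
by rewrite Qeq.
Qed.

End Path.
End QueueDynamics.

Section QueueChain.
Context (R : realType) (n : nat) (p : R) (d d' : measure_display).
Context (Omega : measurableType d) (P : probability Omega R) (U : measurableType d').
Variables (arr : nat -> {RV P >-> nat}) (serv : 'I_n.+1 -> nat -> {RV P >-> bool}).
Variables (seed : nat -> {RV P >-> U}) (policy : qvec n -> U -> qvec n).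
Hypothesis independence : mutually_independent P (primitive_sigma arr serv seed).
Hypothesis arr_id : identically_distributed arr.
Hypothesis serv_law : forall j v, P (serv j v @^-1` [set true]) = p%:E.
Hypothesis seed_id : identically_distributed seed.
Hypothesis policy_measurable : forall q s, measurable [set u | policy q u = s].

Let F := primitive_sigma arr serv seed.
Let index : eqType := (nat + 'I_n.+1 * nat + nat)%type.

Lemma primitive_measurable (i : index) (A : set Omega) : F i A -> measurable A.
Proof.
by case: i => [[t|[j v]]|t] [B mB <-]; apply: measurable_funP.
Qed.

(* The primitive variables consumed in [t] time units, when [m j] units of
   service have been used at each queue [j]. *)
Let used (t : nat) (m : 'I_n.+1 -> nat) (i : index) : bool :=
  match i with
  | inl (inl tau) => (tau < t)%N
  | inl (inr (j, v)) => (v < m j)%N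
  | inr tau => (tau < t)%N
  end.

Definition cylinder (J : pred index) (A : set Omega) :=
  exists s (B : index -> set Omega),
    [/\ uniq s, all J s, forall i, i \in s -> F i (B i) &
      A = \bigcap_(i in [set` s]) B i].

Lemma cylinder_measurable J A : cylinder J A -> measurable A.
Proof.
move=> [s [B [_ _ FB ->]]]; apply: fin_bigcap_measurable; first exact: finite_seq.
by move=> i /= /FB; exact: primitive_measurable.
Qed.

Lemma cylinder_setT J : cylinder J setT.
Proof.
exists [::], (fun=> setT); split => //.
by apply/seteqP; split => // w _ i.
Qed.

Lemma cylinderI (J J' : pred index) A s (B : index -> set Omega) :
  cylinder J A -> uniq s -> (forall i, i \in s -> ~~ J i) ->
  (forall i, i \in s -> F i (B i)) ->
  (forall i, J i || (i \in s) -> J' i) ->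
  cylinder J' (A `&` \bigcap_(i in [set` s]) B i) /\
  fine (P (A `&` \bigcap_(i in [set` s]) B i)) =
    fine (P A) * \prod_(i <- s) fine (P (B i)).
Proof.
move=> [s1 [B1 [us1 Js1 FB1 AE]]] us nJ FB JJ'.
have disj i : i \in s -> i \notin s1.
  by move=> /nJ; apply: contra => /(allP Js1).
pose B2 i := if i \in s1 then B1 i else B i.
have us2 : uniq (s1 ++ s).
  rewrite cat_uniq us1 us andbT /=; apply/hasPn => i; exact: disj.
have FB2 i : i \in s1 ++ s -> F i (B2 i).
  rewrite mem_cat /B2; case: (boolP (i \in s1)) => [/FB1 //|_ /=]; exact: FB.
have E : A `&` \bigcap_(i in [set` s]) B i = \bigcap_(i in [set` s1 ++ s]) B2 i.
  rewrite AE; apply/seteqP; split => w /=.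
    move=> [w1 w2] i /=; rewrite mem_cat /B2.
    by case: (boolP (i \in s1)) => [/w1 //|_ /w2].
  move=> H; split => i /= is1.
    by have := H i; rewrite /= mem_cat is1 /B2 is1; exact.
  by have := H i; rewrite /= mem_cat is1 orbT /B2 (negbTE (disj _ is1)); exact.
split.
  exists (s1 ++ s), B2; split => //.
  apply/allP => i; rewrite mem_cat => /orP[/(allP Js1) Ji|si]; apply: JJ'.
    by rewrite Ji.
  by rewrite si orbT.
rewrite E independence // big_cat /= AE independence //; congr (_ * _).
  by apply: eq_big_seq => i is1; rewrite /B2 is1.
by apply: eq_big_seq => i is1; rewrite /B2 (negbTE (disj _ is1)).
Qed.

Definition outcome_event (y : qvec n) (o : outcome n) (t : nat) (m : 'I_n.+1 -> nat) :=
  [set w | step_outcome arr serv seed policy y t m w = o].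

Section Step.
Variables (y : qvec n) (o : outcome n).
Let k j := minn (o.1.2 j) (y j).

Let fresh : seq index := [:: inl (inl 0%N); inr 0%N] ++
  [seq inl (inr ji) | ji <- [seq (j, i) | j <- enum 'I_n.+1, i <- iota 0 (k j)]].

Let shift t (m : 'I_n.+1 -> nat) (i : index) : index :=
  match i with
  | inl (inl tau) => inl (inl (tau + t)%N)
  | inl (inr (j, v)) => inl (inr (j, v + m j)%N)
  | inr tau => inr (tau + t)%N
  end.

Let base (m : 'I_n.+1 -> nat) (i : index) : set Omega :=
  match i with
  | inl (inl tau) => arr tau @^-1` [set o.1.1]
  | inl (inr (j, v)) => serv j v @^-1` [set nth false (o.2 j) (v - m j)]
  | inr tau => seed tau @^-1` [set u | policy y u = o.1.2]
  end.

Let shift_inj t m : injective (shift t m).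
Proof.
move=> [[t1|[j1 v1]]|t1] [[t2|[j2 v2]]|t2] //= [].
- by move/addIn => ->.
- by move=> -> /addIn ->.
- by move/addIn => ->.
Qed.

Let fresh_uniq : uniq fresh.
Proof.
rewrite cat_uniq; apply/and3P; split => //.
  by apply/hasPn => i /mapP[ji _ ->].
rewrite map_inj_uniq; last by move=> a b [].
apply: allpairs_uniq_dep; first exact: enum_uniq.
  by move=> j _; exact: iota_uniq.
by move=> [a b] [c e] _ _ /= [-> ->].
Qed.

Let mem_fresh_serv j v : (inl (inr (j, v)) \in fresh) = (v < k j)%N.
Proof.
rewrite mem_cat /= mem_map; last by move=> a b [].
apply/allpairsPdep/idP.
  by move=> [a [b [_ + [-> ->]]]]; rewrite mem_iota.
by move=> vk; exists j, v; split; rewrite ?mem_enum // mem_iota.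
Qed.

Let mem_fresh_arr tau : (inl (inl tau) \in fresh) = (tau == 0%N).
Proof.
rewrite mem_cat orbC; case: (boolP (_ \in map _ _)) => [/mapP[? _ //]|_ /=].
by rewrite !inE orbF.
Qed.

Let mem_fresh_seed tau : (inr tau \in fresh) = (tau == 0%N).
Proof.
rewrite mem_cat orbC; case: (boolP (_ \in map _ _)) => [/mapP[? _ //]|_ /=].
by rewrite !inE.
Qed.

Let baseF m i : F i (base m i).
Proof.
case: i => [[t|[j v]]|t] /=.
- by exists [set o.1.1] => //; rewrite setTI.
- by exists [set nth false (o.2 j) (v - m j)] => //; rewrite setTI.
- by exists [set u | policy y u = o.1.2] => //; rewrite setTI.
Qed.

Let serv_lawE j v b : fine (P (serv j v @^-1` [set b])) = if b then p else 1 - p.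
Proof.
case: b; first by rewrite serv_law.
have -> : serv j v @^-1` [set false] = ~` (serv j v @^-1` [set true]).
  by apply/seteqP; split => w /=; case: (serv j v w).
rewrite probability_setC ?serv_law //.
by rewrite -[X in measurable X]setTI; exact: measurable_funP.
Qed.

Let base_shift t m i : fine (P (base m (shift t m i))) = fine (P (base (fun=> 0%N) i)).
Proof.
case: i => [[tau|[j v]]|tau] /=.
- by rewrite arr_id // [in RHS]arr_id.
- by rewrite !serv_lawE addnK subn0.
- by rewrite seed_id // [in RHS]seed_id.
Qed.

Local Notation outcome_set := (outcome_event y o).

Let outcome_setE t m : (forall j, size (o.2 j) = k j) ->
  outcome_set t m = \bigcap_(i in [set` map (shift t m) fresh]) base m i.
Proof.
move=> size_o; apply/seteqP; split => w /=.
  move=> E i imem; have /mapP[i' + ->] : i \in map (shift t m) fresh := imem.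
  case: i' => [[tau|[j v]]|tau].
  - by rewrite mem_fresh_arr => /eqP ->; rewrite /= add0n -E.
  - rewrite mem_fresh_serv => vk; rewrite /= addnK -E /= ffunE nth_mkseq; first by rewrite addnC.
    by move: vk; rewrite /k -E.
  - by rewrite mem_fresh_seed => /eqP ->; rewrite /= add0n -E.
move=> H; have {}H i : i \in fresh -> base m (shift t m i) w.
  by move=> ifresh; exact: (H _ (map_f (shift t m) ifresh)).
have arrE : arr t w = o.1.1 by apply: (H (inl (inl 0%N))); rewrite mem_fresh_arr.
have polE : policy y (seed t w) = o.1.2 by apply: (H (inr 0%N)); rewrite mem_fresh_seed.
rewrite /outcome_event /step_outcome /= arrE polE.
suff -> : [ffun j => mkseq (fun i => serv j (m j + i) w) (minn (o.1.2 j) (y j))] = o.2.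
  by rewrite -!surjective_pairing.
apply/ffunP => j; rewrite ffunE; apply: (@eq_from_nth _ false).
  by rewrite size_mkseq size_o.
move=> i; rewrite size_mkseq => ik; rewrite nth_mkseq //.
by have := H (inl (inr (j, i))); rewrite mem_fresh_serv /= addnK addnC; exact.
Qed.

Let outcome_set0 t m : ~ (forall j, size (o.2 j) = k j) -> outcome_set t m = set0.
Proof.
move=> nsize; apply/seteqP; split => // w /= E; apply: nsize => j.
by rewrite /k -E /= ffunE size_mkseq.
Qed.

Let fresh_unused t m i : i \in map (shift t m) fresh -> ~~ used t m i.
Proof.
by case/mapP => [[[tau|[j v]]|tau] _ ->] /=; rewrite -leqNgt leq_addl.
Qed.

Lemma outcome_cylinder t m A : (forall j, size (o.2 j) = minn (o.1.2 j) (y j)) ->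
  cylinder (used t m) A ->
  cylinder (used t.+1 (fun j => m j + minn (o.1.2 j) (y j))%N) (A `&` outcome_set t m).
Proof.
move=> size_o cA; rewrite outcome_setE //.
apply: (cylinderI cA _ (@fresh_unused t m) _ _).1 => //.
  by rewrite map_inj_uniq.
move=> i /orP[|/mapP[i' + ->]].
  case: i => [[tau|[j v]]|tau] /= h; rewrite ?ltnS ?(ltnW h) //.
  by rewrite ltn_addr.
case: i' => [[tau|[j v]]|tau] /=.
- by rewrite mem_fresh_arr => /eqP ->; rewrite add0n.
- by rewrite mem_fresh_serv addnC ltn_add2l.
- by rewrite mem_fresh_seed => /eqP ->; rewrite add0n.
Qed.

Lemma outcome_independent t m A : cylinder (used t m) A ->
  P (A `&` outcome_set t m) = (P A * P (outcome_set 0 (fun=> 0%N)))%E.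
Proof.
move=> cA; have [size_o|nsize] := pselect (forall j, size (o.2 j) = minn (o.1.2 j) (y j)); last first.
  by rewrite !outcome_set0 // setI0 measure0 mule0.
have prob t' m' A' : cylinder (used t' m') A' ->
    fine (P (A' `&` outcome_set t' m')) =
    fine (P A') * \prod_(i <- fresh) fine (P (base (fun=> 0%N) i)).
  move=> cA'; rewrite outcome_setE //.
  have -> := (@cylinderI _ predT _ _ (base m') cA' _ (@fresh_unused t' m') _ _).2 => //.
    by rewrite big_map; congr (_ * _); apply: eq_bigr => i _; rewrite base_shift.
  by rewrite map_inj_uniq.
have mO t' m' : measurable (outcome_set t' m').
  rewrite -[outcome_set t' m']setTI; apply: cylinder_measurable.
  exact: (outcome_cylinder size_o (cylinder_setT _)).
have mA := cylinder_measurable cA.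
rewrite -[LHS]fineK ?fin_num_measure //; last exact: measurableI.
rewrite prob // -[outcome_set 0 _ in RHS]setTI.
rewrite -[P A]fineK ?fin_num_measure // -[P (setT `&` _)]fineK ?fin_num_measure //; last first.
  exact: measurableI.
by rewrite prob ?probability_setT ?mul1r -?EFinM //; exact: cylinder_setT.
Qed.

End Step.

Section Trajectories.
Variable Q : qvec n -> nat -> Omega -> qvec n.
Hypothesis Q_process : forall x, queueing_process arr serv seed policy (Q x) x.

Let cum x t w j := cum_service seed policy (Q x) j t w.
Let code x t w := path_code arr serv seed policy (Q x) t w.
Let last_outcome x t w := path_outcome arr serv seed policy (Q x) t w.

Let codeS x t w0 : [set w | code x t.+1 w = code x t.+1 w0] =
  [set w | code x t w = code x t w0] `&`
  outcome_event (Q x t w0) (last_outcome x t w0) t (cum x t w0).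
Proof.
apply/seteqP; split => w /=; rewrite /code /path_code !mkseqS.
  move=> /rcons_inj E; have Ec : code x t w = code x t w0 := congr1 fst E.
  have Eo : last_outcome x t w = last_outcome x t w0 := congr1 snd E.
  split => //; rewrite /outcome_event /= -Eo /last_outcome /path_outcome.
  have [Qeq ceq] := path_codeP (Q_process x) Ec.
  by rewrite Qeq //; congr step_outcome; apply/funext => j; rewrite ceq.
move=> [Ec Eo]; have [Qeq ceq] := path_codeP (Q_process x) Ec.
congr rcons => //; rewrite -[RHS]Eo /path_outcome Qeq //.
by congr step_outcome; apply/funext => j; rewrite ceq.
Qed.

Lemma code_cylinder x t w0 :
  cylinder (used t (cum x t w0)) [set w | code x t w = code x t w0].
Proof.
elim: t => [|t IHt].
  rewrite (_ : [set w | _] = setT); first exact: cylinder_setT.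
  by apply/seteqP; split.
rewrite codeS (_ : cum x t.+1 w0 = fun j => (cum x t w0 j +
    minn ((last_outcome x t w0).1.2 j) (Q x t w0 j))%N).
  by apply: outcome_cylinder => // j; rewrite ffunE size_mkseq.
by apply/funext => j; rewrite /cum cum_serviceS.
Qed.

Lemma code_measurable x t h : measurable [set w | code x t w = h].
Proof.
have [[w0 <-]|no] := pselect (exists w0, code x t w0 = h).
  exact: cylinder_measurable (code_cylinder x t w0).
rewrite (_ : [set w | _] = set0) //.
by apply/seteqP; split => // w E; apply: no; exists w.
Qed.

Let same_code x t w w' : code x t w = code x t w' ->
  forall i, (i <= t)%N -> Q x i w = Q x i w'.
Proof. by move=> /(path_codeP (Q_process x))[]. Qed.

Theorem queueing_markov_chain : markov_chain P Q.
Proof.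
have past_code x t G : past_event Q x t G ->
    forall w w', code x t w = code x t w' -> G w -> G w'.
  by move=> pG w w' /same_code ww'; apply: pG.
have Q_measurable x t (f : qvec n -> \bar R) (D : set Omega) :
    measurable_fun D (fun w => f (Q x t w)).
  apply: measurable_funTS; apply: (saturated_measurable_fun (code_measurable x t)).
  by move=> w w' /same_code -> //.
have out_measurable x t (o : outcome n) : measurable [set w | last_outcome x t w = o].
  apply: (saturated_measurable (code_measurable x t.+1)) => w w'.
  rewrite /code /path_code !mkseqS => /rcons_inj E /= <-.
  exact/esym/(congr1 snd E).
split.
- by move=> x w; exact: queueing_process0.
- by move=> x t G /past_code; exact: (saturated_measurable (code_measurable x t)).
- move=> x t G f pG f0.
  have mG : measurable G by exact: (saturated_measurable (code_measurable x t)) (past_code _ _ _ pG).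
  apply: (eq_integral_fibers (code_measurable x t)) => //.
    by move=> w _; apply: integral_ge0.
  move=> h.
  have [[w0 [Gw0 <-]]|no] := pselect (exists w0, G w0 /\ code x t w0 = h); last first.
    rewrite (_ : _ `&` _ = set0) ?integral_set0 //.
    by apply/seteqP; split => // w [Gw E]; apply: no; exists w.
  have -> : G `&` [set w | code x t w = code x t w0] = [set w | code x t w = code x t w0].
    apply/seteqP; split => [w []//|w E]; split => //.
    by apply: (past_code _ _ _ pG _ _ (esym E)).
  set A := [set w | _]; have cA : cylinder _ A := code_cylinder x t w0.
  have mA := cylinder_measurable cA.
  set y := Q x t w0.
  have stepE w : last_outcome y 0 w = step_outcome arr serv seed policy y 0 (fun=> 0%N) w.
    rewrite /last_outcome /path_outcome (queueing_process0 (Q_process y)).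
    by congr step_outcome; apply/funext => j; rewrite /cum_service big_ord0.
  have lastE w : A w -> last_outcome x t w =
      step_outcome arr serv seed policy y t (cum x t w0) w.
    move=> Aw; have [Qeq ceq] := path_codeP (Q_process x) Aw.
    rewrite /last_outcome /path_outcome Qeq //.
    by congr step_outcome; apply/funext => j; rewrite ceq.
  transitivity (P A * transition P Q f y)%E; last first.
    rewrite (eq_integral (cst (transition P Q f y))); last first.
      by move=> w; rewrite inE => Aw; rewrite (same_code Aw).
    by rewrite (integral_cst P mA) muleC.
  rewrite (eq_integral (fun w => f (next y (last_outcome x t w)))); last first.
    by move=> w; rewrite inE => Aw; rewrite (queueing_processS (Q_process x)) (same_code Aw).
  rewrite (ge0_integral_independent (c2 := last_outcome y 0) (g := fun o => f (next y o))) //.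
    congr (_ * _)%E; apply: eq_integral => w _.
    by rewrite (queueing_processS (Q_process y)) (queueing_process0 (Q_process y)).
  move=> o; transitivity (P (A `&` outcome_event y o t (cum x t w0))).
    by congr (P _); apply/seteqP; split => w [Aw]; rewrite /outcome_event /= -lastE.
  rewrite (outcome_independent _ _ cA); congr (_ * P _)%E.
  by apply/seteqP; split => w; rewrite /outcome_event /= -stepE.
Qed.

End Trajectories.
End QueueChain.

(** * The potential *)

Inductive cone (R : realType) (E : lmodType R) (G : E -> Prop) : E -> Prop :=
| cone_gen u : G u -> cone G u
| coneD u v : cone G u -> cone G v -> cone G (u + v)
| coneZ (k : R) u : 0 < k -> cone G u -> cone G (k *: u).

Lemma cone_trans (R : realType) (E : lmodType R) (G G' : E -> Prop) :
  (forall u, G u -> cone G' u) -> forall u, cone G u -> cone G' u.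
Proof.
move=> GG' u; elim=> [v /GG' //|v w _ ? _ ?|k v k0 _ ?]; first exact: coneD.
exact: coneZ.
Qed.

Lemma separating_value (R : realType) (lo hi : seq R) :
  (forall l h, l \in lo -> h \in hi -> l < h) ->
  exists x, (forall l, l \in lo -> l < x) /\ (forall h, h \in hi -> x < h).
Proof.
elim: hi => [|h0 hi IH] H.
  exists (\big[Num.max/0]_(l <- lo) l + 1); split => // l llo.
  have := le_bigmax_seq 0 _ predT (fun x => x) llo (erefl true).
  by move=> /le_lt_trans; apply; rewrite ltrDl.
have [|x [lox xhi]] := IH; first by move=> l h llo hhi; apply: H => //; rewrite inE hhi orbT.
have [xh|hx] := ltP x h0.
  by exists x; split => // h; rewrite inE => /predU1P[->|/xhi].
pose m := \big[Num.max/(h0 - 1)]_(l <- lo) l.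
have mh : m < h0.
  rewrite /m; elim: lo H {IH lox m} => [|l lo IHlo] H.
    by rewrite big_nil ltrBlDr ltrDl.
  rewrite big_cons gt_max H ?mem_head //= IHlo // => l' h l'lo; apply: H.
  by rewrite inE l'lo orbT.
exists ((m + h0) / 2); split => [l llo|h].
  by have := le_bigmax_seq (h0 - 1) _ predT (fun x => x) llo (erefl true); rewrite -/m; lra.
rewrite inE => /predU1P[->|/xhi]; lra.
Qed.

(* Ville's theorem of the alternative, by Fourier-Motzkin elimination of the
   functionals one at a time. *)
Lemma ville_alternative (R : realType) (E : lmodType R) (m : nat)
    (l : nat -> E -> R) (cs : seq E) :
  (forall i u v, l i (u + v) = l i u + l i v) ->
  (forall i k u, l i (k *: u) = k * l i u) ->
  (exists x : nat -> R, (forall i, 0 <= x i) /\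
     forall c, c \in cs -> \sum_(i < m) x i * l i c < 0) \/
  (exists u, cone (fun c => c \in cs) u /\ forall i, (i < m)%N -> 0 <= l i u).
Proof.
move=> lD lZ; elim: m cs => [|m IHm] cs.
  case: cs => [|c cs]; first by left; exists (fun=> 0).
  by right; exists c; split => //; apply: cone_gen; rewrite mem_head.
pose r := l m.
pose comb (u : E * E) := r u.2 *: u.1 + (- r u.1) *: u.2.
pose cs' := [seq c <- cs | 0 <= r c] ++
  [seq comb u | u <- [seq (a, b) | a <- [seq c <- cs | r c < 0], b <- [seq c <- cs | 0 < r c]]].
have combP a b : a \in cs -> b \in cs -> r a < 0 -> 0 < r b -> comb (a, b) \in cs'.
  move=> acs bcs ra rb; rewrite mem_cat; apply/orP; right; apply: map_f.
  by apply: allpairs_f; rewrite mem_filter ?ra ?rb.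
case: (IHm cs') => [[x [x0 xneg]]|[u [cu lu]]]; last first.
- right; exists u.
  have gen c : c \in cs' -> cone (fun c => c \in cs) c /\ 0 <= r c.
    rewrite mem_cat => /orP[|/mapP[[a b] /allpairsP[[a' b']]]].
      by rewrite mem_filter => /andP[rc ccs]; split => //; exact: cone_gen.
    rewrite !mem_filter /= => -[/andP[ra acs] /andP[rb bcs] [-> ->]] ->; split.
      apply: coneD; apply: coneZ; rewrite ?oppr_gt0 //; exact: cone_gen.
    by rewrite /comb /r lD !lZ /= -/r mulrC mulNr subrr.
  have cone_r : cone (fun c => c \in cs) u /\ 0 <= r u.
    elim: cu => [c /gen //|v w _ [cv rv] _ [cw rw]|k v k0 _ [cv rv]].
      by split; [exact: coneD|rewrite /r lD addr_ge0].
    by split; [exact: coneZ|rewrite /r lZ mulr_ge0 // ltW].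
  split; first exact: cone_r.1.
  by move=> i; rewrite ltnS leq_eqVlt => /predU1P[->|/lu //]; exact: cone_r.2.
- left; pose s c := \sum_(i < m) x i * l i c.
  have sD u v : s (u + v) = s u + s v.
    by rewrite /s -big_split; apply: eq_bigr => i _ /=; rewrite lD mulrDr.
  have sZ k u : s (k *: u) = k * s u.
    by rewrite /s mulr_sumr; apply: eq_bigr => i _ /=; rewrite lZ mulrCA.
  have sneg c : c \in cs -> 0 <= r c -> s c < 0.
    by move=> ccs rc; apply: xneg; rewrite mem_cat mem_filter rc ccs.
  have scomb a b : a \in cs -> b \in cs -> r a < 0 -> 0 < r b -> r b * s a - r a * s b < 0.
    move=> acs bcs ra rb; have := xneg _ (combP a b acs bcs ra rb).
    by rewrite -/(s _) sD !sZ /= mulNr.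
  have [|t [lot thi]] := @separating_value R
      (0 :: [seq s a / - r a | a <- cs & r a < 0]) [seq - s b / r b | b <- cs & 0 < r b].
    move=> lo hi + /mapP[b]; rewrite mem_filter => + /andP[rb bcs] ->.
    rewrite inE => /predU1P[->|/mapP[a]].
      by rewrite divr_gt0 // oppr_gt0 sneg // ltW.
    rewrite mem_filter => /andP[ra acs] ->.
    rewrite ltr_pdivrMr ?oppr_gt0 // mulrAC ltr_pdivlMr //.
    by have := scomb a b acs bcs ra rb; lra.
  have t0 : 0 < t by apply: lot; rewrite mem_head.
  exists (fun i => if (i < m)%N then x i else t); split.
    by move=> i; case: ifP => // _; exact: ltW.
  move=> c ccs; rewrite big_ord_recr /= ltnn.
  rewrite (eq_bigr (fun i : 'I_m => x i * l i c)); last by move=> i _; rewrite ltn_ord.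
  rewrite -/(s c) -/r; have [rc|rc|rc] := ltgtP (r c) 0.
  + have : s c / - r c < t.
      by apply: lot; rewrite inE; apply/orP; right; apply: map_f; rewrite mem_filter rc.
    by rewrite ltr_pdivrMr ?oppr_gt0 //; lra.
  + have : t < - s c / r c by apply: thi; apply: (map_f (fun b => - s b / r b)); rewrite mem_filter rc.
    by rewrite ltr_pdivlMr //; lra.
  + by rewrite rc mulr0 addr0 sneg // rc.
Qed.

Lemma uniform_pos (R : realType) (I : finType) (Q : I -> R -> Prop) :
  (forall i, exists2 e, 0 < e & forall e', 0 < e' <= e -> Q i e') ->
  exists2 e, 0 < e & forall i, Q i e.
Proof.
move=> H; have /choice[f Hf] : forall i, exists e, 0 < e /\ forall e', 0 < e' <= e -> Q i e'.
  by move=> i; have [e e0 He] := H i; exists e.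
have e0 : 0 < \big[Num.min/1]_i f i.
  by apply: lt_bigmin => // i _; exact: (Hf i).1.
exists (\big[Num.min/1]_i f i) => // i; apply: (Hf i).2.
by rewrite e0 bigmin_le.
Qed.

Section Geometry.
Variables (R : realType) (n : nat).
Local Notation E := 'rV[R]_n.+1.

Definition dot (u v : E) : R := \sum_j u 0 j * v 0 j.

Lemma dotC u v : dot u v = dot v u.
Proof. by apply: eq_bigr => j _; rewrite mulrC. Qed.

Lemma dotDr u v w : dot u (v + w) = dot u v + dot u w.
Proof. by rewrite /dot -big_split; apply: eq_bigr => j _; rewrite mxE mulrDr. Qed.

Lemma dotZr u k v : dot u (k *: v) = k * dot u v.
Proof. by rewrite /dot mulr_sumr; apply: eq_bigr => j _; rewrite mxE mulrCA. Qed.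

Lemma dotDl u v w : dot (u + v) w = dot u w + dot v w.
Proof. by rewrite ![dot _ w]dotC dotDr. Qed.

Lemma dotZl k u v : dot (k *: u) v = k * dot u v.
Proof. by rewrite dotC dotZr dotC. Qed.

Lemma dot_delta0 u : dot u (delta_mx 0 0) = u 0 0.
Proof.
rewrite /dot (bigD1 0) //= big1 ?addr0 ?mxE ?eqxx ?mulr1 // => j j0.
by rewrite mxE (negbTE j0) mulr0.
Qed.

Lemma dot_suml (I : finType) (r : pred I) (x : I -> R) (u : I -> E) v :
  dot (\sum_(i | r i) x i *: u i) v = \sum_(i | r i) x i * dot (u i) v.
Proof.
elim/big_ind2: _ => [|a b c e <- <-|i _]; first by rewrite /dot big1 // => j _; rewrite mxE mul0r.
  by rewrite dotDl.
by rewrite dotZl.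
Qed.

(* With [z] the excess of the service rates over the traffic intensity,
   [p *: shift_diff z] is the vector of mean increments of the queues. *)
Definition shift_diff (z : E) : E :=
  \row_j ((if j == ord0 then 0 else z 0 (inord j.-1)) - z 0 j).

Lemma shift_diffD u v : shift_diff (u + v) = shift_diff u + shift_diff v.
Proof. by apply/rowP => j; rewrite !mxE; case: eqP => _; ring. Qed.

Lemma shift_diffZ k u : shift_diff (k *: u) = k *: shift_diff u.
Proof. by apply/rowP => j; rewrite !mxE; case: eqP => _; ring. Qed.

Lemma dot_shift_diff_lt0 z : z != 0 -> dot z (shift_diff z) < 0.
Proof.
move=> z0; pose zz k := if k is k'.+1 then z 0 (inord k') else 0.
have zzE j : z 0 j = zz j.+1 by rewrite /zz inord_val.
have -> : dot z (shift_diff z) = \sum_(k < n.+1) zz k.+1 * (zz k - zz k.+1).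
  apply: eq_bigr => j _; rewrite mxE -zzE; congr (_ * (_ - _)).
  by case: j => [[|j] ltj].
have sqE N : \sum_(k < N) zz k.+1 * (zz k - zz k.+1) =
    - (zz N ^+ 2 + \sum_(k < N) (zz k.+1 - zz k) ^+ 2) / 2.
  elim: N => [|N IHN]; first by rewrite !big_ord0 /zz; lra.
  by rewrite !big_ord_recr /= IHN; lra.
rewrite sqE mulNr oppr_lt0 divr_gt0 //.
have sq_ge0 : 0 <= \sum_(k < n.+1) (zz k.+1 - zz k) ^+ 2.
  by apply: sumr_ge0 => k _; exact: sqr_ge0.
rewrite ltr_wpDl ?sqr_ge0 // lt_def sq_ge0 andbT; apply: contra z0 => /eqP sq0.
have zzS k : (k < n.+1)%N -> zz k.+1 = zz k.
  move=> kn; apply/eqP; rewrite -subr_eq0 -sqrf_eq0; apply/eqP.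
  have := @psumr_eq0P _ _ predT (fun k : 'I_n.+1 => (zz k.+1 - zz k) ^+ 2)
    (fun k _ => sqr_ge0 _) sq0 (Ordinal kn) isT; exact.
apply/eqP/rowP => j; rewrite mxE zzE zzS //.
elim: {j}(j : nat) (ltn_ord j) => [//|k IHk] kn.
by rewrite zzS ?IHk // ltnW.
Qed.

Section Potential.
Variables (N : nat) (z : 'I_N -> E).

Definition admissible (F : {set 'I_N}) : Prop :=
  F != finset.set0 /\ ~ cone (fun u => exists2 i, i \in F & u = z i) 0.

Lemma admissible_halfspace (F : {set 'I_N}) q : F != finset.set0 ->
  (forall i, i \in F -> 0 < dot (z i) q) -> admissible F.
Proof.
move=> F0 Fq; split => // c0.
suff : 0 < dot (0 : E) q by rewrite /dot big1 ?ltxx // => j _; rewrite mxE mul0r.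
elim: c0 => [u [i iF ->]|u v _ ? _ ?|k u k0 _ ?]; first exact: Fq.
  by rewrite dotDl addr_gt0.
by rewrite dotZl mulr_gt0.
Qed.

Lemma admissible_weights (F : {set 'I_N}) : admissible F ->
  exists x : 'I_N -> R, [/\ forall i, i \in F -> 0 < x i,
    forall i, i \notin F -> x i = 0, \sum_i x i = 1 &
    forall k, k \in F -> dot (\sum_i x i *: z i) (shift_diff (z k)) < 0].
Proof.
move=> [/set0Pn[k0 k0F] ncone].
pose l (i : nat) u := if insub i is Some i' then
  if i' \in F then dot (z i') (shift_diff u) else 0 else 0.
have lE (i : 'I_N) u : l i u = if i \in F then dot (z i) (shift_diff u) else 0.
  by rewrite /l valK.
have lD i u v : l i (u + v) = l i u + l i v.
  rewrite /l; case: insub => [i'|]; last by rewrite addr0.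
  by case: ifP => _; rewrite ?addr0 // shift_diffD dotDr.
have lZ i k u : l i (k *: u) = k * l i u.
  rewrite /l; case: insub => [i'|]; last by rewrite mulr0.
  by case: ifP => _; rewrite ?mulr0 // shift_diffZ dotZr.
have [[x [x0 xneg]]|[u [cu lu]]] := ville_alternative N [seq z i | i <- enum F] lD lZ; last first.
  case: ncone.
  have {}cu : cone (fun u => exists2 i, i \in F & u = z i) u.
    move: u cu {lu}; apply: cone_trans => _ /mapP[i iF ->]; apply: cone_gen; exists i => //.
    by rewrite -mem_enum.
  have [u0|un0] := eqVneq u 0; first by rewrite u0 in cu.
  have := dot_shift_diff_lt0 un0; rewrite ltNge => /negP[].
  have gen v : cone (fun u => exists2 i, i \in F & u = z i) v -> 0 <= dot v (shift_diff u).
    elim=> [_ [i iF ->]|a b _ ? _ ?|k a k1 _ ?].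
    - by have := lu i (ltn_ord i); rewrite lE iF.
    - by rewrite dotDl addr_ge0.
    - by rewrite dotZl mulr_ge0 // ltW.
  exact: gen.
have [e e0 He] : exists2 e, 0 < e & forall k : 'I_N, k \in F ->
    \sum_(i in F) (x i + e) * dot (z i) (shift_diff (z k)) < 0.
  apply: (@uniform_pos R 'I_N (fun k e => k \in F ->
    \sum_(i in F) (x i + e) * dot (z i) (shift_diff (z k)) < 0)) => k.
  have [kF|kF] := boolP (k \in F); last by exists 1.
  pose s := \sum_(i in F) x i * dot (z i) (shift_diff (z k)).
  pose t := \sum_(i in F) dot (z i) (shift_diff (z k)).
  have s0 : s < 0.
    have -> : s = \sum_(i < N) x i * l i (z k).
      rewrite /s big_mkcond /=; apply: eq_bigr => i _; rewrite lE.
      by case: ifP => _; rewrite ?mulr0.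
    by apply: xneg; rewrite map_f // mem_enum.
  exists (- s / (2 * (`|t| + 1))).
    by rewrite divr_gt0 ?oppr_gt0 // mulr_gt0 // ltr_wpDl.
  move=> e' /andP[e'0 e's] _.
  have -> : \sum_(i in F) (x i + e') * dot (z i) (shift_diff (z k)) = s + e' * t.
    by rewrite /s /t mulr_sumr -big_split; apply: eq_bigr => i _ /=; rewrite mulrDl.
  have t1 : 0 < `|t| + 1 by rewrite ltr_wpDl.
  move: e's; rewrite ler_pdivlMr ?mulr_gt0 // => e's.
  have : e' * t <= e' * `|t| by rewrite ler_wpM2l ?(ltW e'0) // ler_norm.
  nra.
pose S := \sum_(i in F) (x i + e).
have S0 : 0 < S.
  rewrite /S (bigD1 k0) //= ltr_pwDl //; first by rewrite ltr_wpDl.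
  by apply: sumr_ge0 => i _; rewrite addr_ge0 // ltW.
exists (fun i => if i \in F then (x i + e) / S else 0); split.
- by move=> i ->; rewrite divr_gt0 // ltr_wpDl.
- by move=> i /negbTE ->.
- by rewrite -big_mkcond /= -mulr_suml divff // gt_eqF.
- move=> k kF; rewrite dot_suml.
  rewrite (eq_bigr (fun i => if i \in F then
      (x i + e) * dot (z i) (shift_diff (z k)) / S else 0)); last first.
    by move=> i _; case: ifP => _; rewrite ?mul0r // mulrAC.
  by rewrite -big_mkcond /= -mulr_suml pmulr_llt0 ?invr_gt0 // He.
Qed.

End Potential.
End Geometry.

Section Softmax.
Variables (R : realType) (I : finType) (a : pred I) (beta : R).
Hypothesis beta_gt0 : 0 < beta.
Hypothesis a_nonempty : exists i, a i.

Definition sumexp (l : I -> R) : R := \sum_(i | a i) expR (l i / beta).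
Definition softmax (l : I -> R) : R := beta * ln (sumexp l).
Definition softmax_weight (l : I -> R) (i : I) : R := expR (l i / beta) / sumexp l.

Lemma sumexp_ge l i : a i -> expR (l i / beta) <= sumexp l.
Proof.
by move=> ai; rewrite /sumexp (bigD1 i) //= lerDl sumr_ge0 // => j _; exact: expR_ge0.
Qed.

Lemma sumexp_gt0 l : 0 < sumexp l.
Proof.
by have [i ai] := a_nonempty; apply: lt_le_trans (sumexp_ge l ai); exact: expR_gt0.
Qed.

Lemma softmax_ge l i : a i -> l i <= softmax l.
Proof.
move=> ai; rewrite /softmax mulrC -ler_pdivrMr // -[leLHS]expRK.
by rewrite ler_ln ?posrE ?expR_gt0 ?sumexp_gt0 // sumexp_ge.
Qed.

Lemma softmax_weight_ge0 l i : 0 <= softmax_weight l i.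
Proof. by rewrite divr_ge0 ?expR_ge0 // ltW // sumexp_gt0. Qed.

Lemma softmax_weight_sum l : \sum_(i | a i) softmax_weight l i = 1.
Proof. by rewrite -mulr_suml divff // gt_eqF // sumexp_gt0. Qed.

Lemma softmax_weight_le l c i j : a j -> l i + c <= l j ->
  softmax_weight l i <= expR (- (c / beta)).
Proof.
move=> aj lij; rewrite ler_pdivrMr ?sumexp_gt0 //.
apply: (@le_trans _ _ (expR (- (c / beta)) * expR (l j / beta))).
  by rewrite -expRD ler_expR addrC -mulrBl ler_wpM2r ?invr_ge0 ?(ltW beta_gt0) //; lra.
by rewrite ler_wpM2l ?expR_ge0 // sumexp_ge.
Qed.

Lemma expR_le_quad (x : R) : `|x| <= 1 / 2 -> expR x <= 1 + x + 2 * x ^+ 2.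
Proof.
rewrite ler_norml => /andP[x1 x2].
have : expR x * expR (- x) = 1 by rewrite expRxMexpNx_1.
have := expR_ge1Dx (- x); have := expR_gt0 x.
set e := expR x; set e' := expR (- x) => e0 h ee'.
have h1 : e * (1 - x) <= 1 by rewrite -[leRHS]ee' ler_pM2l.
have x20 : 0 <= x ^+ 2 by exact: sqr_ge0.
have : e * (1 - x) <= (1 + x + 2 * x ^+ 2) * (1 - x).
  apply: le_trans h1 _; nra.
by rewrite ler_pM2r //; lra.
Qed.

Lemma softmax_increment (l l' y : I -> R) (T h : R) :
  (forall i, a i -> l' i <= l i + y i + T) ->
  (forall i, a i -> `|y i| <= h) -> h <= beta / 2 ->
  softmax l' <= softmax l + \sum_(i | a i) softmax_weight l i * y i + T + 2 * h ^+ 2 / beta.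
Proof.
move=> ll' yh hb; have [i0 ai0] := a_nonempty.
have h0 : 0 <= h := le_trans (normr_ge0 _) (yh i0 ai0).
pose Y := \sum_(i | a i) softmax_weight l i * y i.
pose c := T / beta + (Y / beta + 2 * (h / beta) ^+ 2).
have expl' i : a i -> expR (l' i / beta) <=
    expR (T / beta) * (expR (l i / beta) * (1 + 2 * (h / beta) ^+ 2 + y i / beta)).
  move=> ai; apply: (@le_trans _ _ (expR (T / beta) * (expR (l i / beta) * expR (y i / beta)))).
    rewrite -!expRD ler_expR -!mulrDl ler_pM2r ?invr_gt0 //.
    by have := ll' i ai; lra.
  rewrite ler_wpM2l ?expR_ge0 // ler_wpM2l ?expR_ge0 //.
  have yb : `|y i / beta| <= h / beta.
    by rewrite normrM normfV (gtr0_norm beta_gt0) ler_pM2r ?invr_gt0 // yh.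
  have hb2 : h / beta <= 1 / 2 by rewrite ler_pdivrMr //; lra.
  apply: le_trans (expR_le_quad (le_trans yb hb2)) _.
  have : (y i / beta) ^+ 2 <= (h / beta) ^+ 2.
    by rewrite -[leLHS]real_normK ?num_real // lerXn2r ?nnegrE // (le_trans _ yb).
  lra.
have W0 := sumexp_gt0 l.
have W' : sumexp l' <= expR c * sumexp l.
  apply: (@le_trans _ _ (expR (T / beta) * (sumexp l * (1 + (Y / beta + 2 * (h / beta) ^+ 2))))).
    apply: le_trans (ler_sum _ expl') _.
    rewrite -mulr_sumr ler_wpM2l ?expR_ge0 //.
    have -> : Y = (\sum_(i | a i) expR (l i / beta) * y i) / sumexp l.
      by rewrite /Y mulr_suml; apply: eq_bigr => i _; rewrite /softmax_weight mulrAC.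
    rewrite (eq_bigr (fun i => expR (l i / beta) * (1 + 2 * (h / beta) ^+ 2) +
       expR (l i / beta) * y i / beta)); last by move=> i _; rewrite mulrDr mulrA.
    rewrite big_split /= -!mulr_suml -/(sumexp l) le_eqVlt; apply/orP; left; apply/eqP.
    by field; rewrite !gt_eqF.
  rewrite /c expRD -mulrA ler_wpM2l ?expR_ge0 // mulrC ler_pM2r //.
  exact: expR_ge1Dx.
rewrite /softmax; have : ln (sumexp l') <= ln (sumexp l) + c.
  rewrite -[c in leRHS]expRK -lnM ?posrE ?expR_gt0 // mulrC.
  by rewrite ler_ln ?posrE ?mulr_gt0 ?expR_gt0 ?sumexp_gt0.
rewrite -(ler_pM2l beta_gt0) => H; apply: le_trans H _.
rewrite /c le_eqVlt; apply/orP; left; apply/eqP; rewrite -/Y.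
by field; rewrite gt_eqF.
Qed.

End Softmax.

(* Heights of the affine pieces of the potential: a larger set of schedules
   gets a larger constant, so that [F] is dominated at every point where a
   schedule outside of [F] is nearly optimal. *)
Fixpoint height (R : realType) (w b c : R) (k : nat) : R :=
  if k is k'.+1 then height w b c k' + (height w b c k' + c) / w + b + c else 0.

Lemma height_ge0 (R : realType) (w b c : R) k :
  0 < w -> 0 <= b -> 0 <= c -> 0 <= height w b c k.
Proof.
move=> w0 b0 c0; elim: k => //= k IHk.
by rewrite !addr_ge0 // divr_ge0 ?addr_ge0 // ltW.
Qed.

Lemma height_nd (R : realType) (w b c : R) k l :
  0 < w -> 0 <= b -> 0 <= c -> (k <= l)%N -> height w b c k <= height w b c l.
Proof.
move=> w0 b0 c0 /subnKC <-; elim: (l - k)%N => [|m IHm]; first by rewrite addn0.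
rewrite addnS /= (le_trans IHm) // -!addrA lerDl !addr_ge0 //.
by rewrite divr_ge0 ?addr_ge0 ?height_ge0 // ltW.
Qed.

Lemma potential_exists (R : realType) (n N : nat) (z : 'I_N -> 'rV[R]_n.+1) (b : R) :
  (exists i q, 0 < dot (z i) q) -> 0 <= b ->
  exists delta K : R, [/\ 0 < delta, 0 < K & forall eta C : R, 0 < eta -> 0 <= C ->
    exists (V : 'rV[R]_n.+1 -> R) (Gamma : 'rV[R]_n.+1 -> 'rV[R]_n.+1) (r : R),
    [/\ forall q j, `|Gamma q 0 j| <= K,
      forall q (u : 'rV_n.+1) t, \sum_j `|u 0 j| <= C -> 0 <= t ->
        V (q + u + t *: delta_mx 0 0) <= V q + dot (Gamma q) u + eta + K * t,
      forall q i k, r <= dot (z i) q -> (forall j, dot (z j) q <= dot (z i) q) ->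
        dot (z i) q - b <= dot (z k) q -> dot (Gamma q) (shift_diff (z k)) <= - delta,
      forall q i, 0 < dot (z i) q -> dot (z i) q <= V q &
      0 <= V 0]].
Proof.
move=> [i0 [q0 z_pos]] b0.
have /choice[x Hx] : forall F : {set 'I_N}, exists x : 'I_N -> R,
    admissible z F -> [/\ forall i, i \in F -> 0 < x i,
      forall i, i \notin F -> x i = 0, \sum_i x i = 1 &
      forall k, k \in F -> dot (\sum_i x i *: z i) (shift_diff (z k)) < 0].
  move=> F; have [/admissible_weights[x Hx]|] := pselect (admissible z F); first by exists x.
  by exists (fun=> 0).
pose g F := \sum_i x F i *: z i.
pose a : pred {set 'I_N} := fun F => `[< admissible z F >].
have a1 i q : 0 < dot (z i) q -> a [set i]%SET.
  move=> ziq; apply/asboolP; apply: (@admissible_halfspace _ _ _ _ _ q).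
    by apply/set0Pn; exists i; rewrite set11.
  by move=> j; rewrite inE => /eqP ->.
have a_nonempty : exists F, a F by exists [set i0]%SET; exact: a1 z_pos.
have [d0 d0_gt0 Hd0] : exists2 e, 0 < e & forall u : {set 'I_N} * 'I_N,
    a u.1 -> u.2 \in u.1 -> dot (g u.1) (shift_diff (z u.2)) <= - e.
  apply: (@uniform_pos R _ (fun (u : {set 'I_N} * 'I_N) e =>
    a u.1 -> u.2 \in u.1 -> dot (g u.1) (shift_diff (z u.2)) <= - e)) => -[F k] /=.
  have [/asboolP/Hx[_ _ _ H]|] := boolP (a F); last by exists 1.
  have [kF|kF] := boolP (k \in F); last by exists 1.
  exists (- dot (g F) (shift_diff (z k))); first by rewrite oppr_gt0; exact: H.
  by move=> e /andP[e0 ele] _ _; rewrite lerNr.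
have [w w_gt0 Hw] : exists2 e, 0 < e & forall u : {set 'I_N} * 'I_N,
    a u.1 -> u.2 \in u.1 -> e <= x u.1 u.2.
  apply: (@uniform_pos R _ (fun (u : {set 'I_N} * 'I_N) e =>
    a u.1 -> u.2 \in u.1 -> e <= x u.1 u.2)) => -[F k] /=.
  have [/asboolP/Hx[H _ _ _]|] := boolP (a F); last by exists 1.
  have [kF|kF] := boolP (k \in F); last by exists 1.
  exists (x F k); first exact: H.
  by move=> e /andP[].
have x_ge0 F i : a F -> 0 <= x F i.
  move=> /asboolP/Hx[H1 H2 _ _]; have [iF|iF] := boolP (i \in F); last by rewrite H2.
  by rewrite ltW // H1.
have x_sum F : a F -> \sum_i x F i = 1 by move=> /asboolP/Hx[].
pose K := 1 + \sum_i \sum_j `|z i 0 j|.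
have zK i j : `|z i 0 j| <= K.
  rewrite /K (bigD1 i) //= (bigD1 j) //=.
  have : 0 <= \sum_(j' | j' != j) `|z i 0 j'| by exact: sumr_ge0.
  have : 0 <= \sum_(i' | i' != i) \sum_j `|z i' 0 j|.
    by apply: sumr_ge0 => ? _; exact: sumr_ge0.
  lra.
have K_gt0 : 0 < K.
  by rewrite ltr_pwDl // sumr_ge0 // => i _; exact: sumr_ge0.
have gK F j : a F -> `|g F 0 j| <= K.
  move=> aF; rewrite /g summxE (le_trans (ler_norm_sum _ _ _)) //.
  rewrite -[K]mul1r -(x_sum F aF) mulr_suml; apply: ler_sum => i _.
  by rewrite mxE normrM ger0_norm ?x_ge0 // ler_wpM2l ?x_ge0.
pose Kb := \sum_(F : {set 'I_N}) \sum_k `|dot (g F) (shift_diff (z k))|.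
have gKb F k : dot (g F) (shift_diff (z k)) <= Kb.
  rewrite (le_trans (ler_norm _)) // /Kb (bigD1 F) //= (bigD1 k) //=.
  have : 0 <= \sum_(j | j != k) `|dot (g F) (shift_diff (z j))| by exact: sumr_ge0.
  have : 0 <= \sum_(i | i != F) \sum_k `|dot (g i) (shift_diff (z k))|.
    by apply: sumr_ge0 => ? _; exact: sumr_ge0.
  lra.
have Kb_ge0 : 0 <= Kb by apply: sumr_ge0 => ? _; exact: sumr_ge0.
exists (d0 / 2), K; split => // [|eta C eta_gt0 C_ge0]; first by rewrite divr_gt0.
pose M := #|{set 'I_N}|%:R * (d0 + Kb).
have M_ge0 : 0 <= M by rewrite mulr_ge0 // addr_ge0 // ltW.
pose kappa := 2 * M / d0.
have kappa_ge0 : 0 <= kappa by apply: divr_ge0 (ltW d0_gt0); rewrite mulr_ge0.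
pose h := K * C.
have h_ge0 : 0 <= h by rewrite mulr_ge0 // ltW.
pose beta := 1 + 2 * h + 2 * h ^+ 2 / eta.
have h2_ge0 : 0 <= h ^+ 2 / eta by rewrite divr_ge0 ?sqr_ge0 // ltW.
have beta_gt0 : 0 < beta by move: h2_ge0; rewrite /beta -mulrA; lra.
pose c := kappa * beta.
have c_ge0 : 0 <= c by rewrite mulr_ge0 // ltW.
pose L k := height w b c k.
have L_ge0 k : 0 <= L k by exact: height_ge0.
pose l q (F : {set 'I_N}) := dot (g F) q + L #|F|.
pose Gamma q := \sum_(F | a F) softmax_weight a beta (l q) F *: g F.
have GammaE q u : dot (Gamma q) u = \sum_(F | a F) softmax_weight a beta (l q) F * dot (g F) u.
  by rewrite /Gamma dot_suml.
have w_ge0 q F : 0 <= softmax_weight a beta (l q) F by exact: softmax_weight_ge0.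
have w_sum q : \sum_(F | a F) softmax_weight a beta (l q) F = 1 by exact: softmax_weight_sum.
have l1 q i : 0 < dot (z i) q -> dot (z i) q <= l q [set i]%SET.
  move=> /[dup] ziq /a1 /asboolP/Hx[_ x0 xs _].
  have x1 : x [set i]%SET i = 1.
    rewrite -xs (bigD1 i) //= big1 ?addr0 // => j ji.
    by rewrite x0 // inE.
  have -> : l q [set i]%SET = dot (z i) q + L #|[set i]%SET|.
    rewrite /l /g dot_suml (bigD1 i) //= x1 mul1r big1 ?addr0 // => j ji.
    by rewrite x0 ?mul0r // inE.
  by rewrite lerDl.
exists (fun q => softmax a beta (l q)), Gamma, ((L N + c) / w + b + 1); split.
- move=> q j; rewrite /Gamma summxE (le_trans (ler_norm_sum _ _ _)) //.
  rewrite -[K]mul1r -(w_sum q) mulr_suml; apply: ler_sum => F aF.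
  by rewrite mxE normrM ger0_norm // ler_wpM2l // gK.
- move=> q u t uC t0.
  have uh F : a F -> `|dot (g F) u| <= h.
    move=> aF; rewrite /dot (le_trans (ler_norm_sum _ _ _)) //.
    apply: (@le_trans _ _ (K * \sum_j `|u 0 j|)); last by rewrite ler_wpM2l // ltW.
    by rewrite mulr_sumr; apply: ler_sum => j _; rewrite normrM ler_wpM2r // gK.
  have := @softmax_increment _ _ a beta beta_gt0 a_nonempty (l q)
    (l (q + u + t *: delta_mx 0 0)) (fun F => dot (g F) u) (K * t) h.
  rewrite -GammaE => H; apply: le_trans (H _ uh _) _.
  + move=> F aF; rewrite /l !dotDr dotZr dot_delta0.
    have : t * g F 0 0 <= t * K.
      by rewrite ler_wpM2l // (le_trans (ler_norm _)) // gK.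
    lra.
  + by move: h2_ge0; rewrite /beta -mulrA; lra.
  + have : 2 * h ^+ 2 / beta <= eta.
      rewrite ler_pdivrMr // -ler_pdivrMl // mulrC.
      by rewrite /beta; move: h2_ge0; rewrite mulrA; lra.
    lra.
- move=> q i k hr imax kb.
  set v := dot (z i) q in hr imax kb.
  have v_gt0 : 0 < v.
    have : 0 <= (L N + c) / w by rewrite divr_ge0 ?addr_ge0 // ltW.
    lra.
  have small F : a F -> k \notin F -> softmax_weight a beta (l q) F <= expR (- kappa).
    move=> aF kF.
    have -> : kappa = c / beta by rewrite /c mulfK // gt_eqF.
    suff [G [aG lG]] : exists G, a G /\ l q F + c <= l q G by exact: softmax_weight_le lG.
    pose D := (L #|F| + c) / w.
    have D_ge0 : 0 <= D by rewrite divr_ge0 ?addr_ge0 // ltW.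
    have gq : dot (g F) q = \sum_j x F j * dot (z j) q by rewrite /g dot_suml.
    have gv : v - dot (g F) q = \sum_j x F j * (v - dot (z j) q).
      rewrite gq -[v in LHS]mul1r -(x_sum F aF) mulr_suml -sumrB.
      by apply: eq_bigr => j _; rewrite mulrBr.
    have terms_ge0 j : 0 <= x F j * (v - dot (z j) q).
      by rewrite mulr_ge0 ?x_ge0 // subr_ge0.
    have [[j jF jD]|near] := pselect (exists2 j, j \in F & dot (z j) q < v - D).
      exists [set i]%SET; split; first exact: a1 v_gt0.
      apply: le_trans (l1 q i v_gt0); rewrite -/v /l.
      have : w * D <= v - dot (g F) q.
        rewrite gv (bigD1 j) //= -[leLHS]addr0 lerD //; last first.
          by apply: sumr_ge0 => j' _; exact: terms_ge0.
        have wx := Hw (F, j) aF jF.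
        by rewrite ler_pM // ?(ltW w_gt0) //; lra.
      by rewrite /D mulrC divfK ?gt_eqF //; lra.
    have {}near j : j \in F -> v - D <= dot (z j) q.
      by move=> jF; rewrite leNgt; apply/negP => h'; apply: near; exists j.
    have DN : D <= (L N + c) / w.
      rewrite ler_pM2r ?invr_gt0 // lerD2r; apply: height_nd => //.
      by rewrite -[N in leqRHS]card_ord max_card.
    have Gq j : j \in (k |: F)%SET -> v - D - b <= dot (z j) q.
      rewrite !inE => /predU1P[->|/near]; lra.
    have aG : a (k |: F)%SET.
      apply/asboolP; apply: (@admissible_halfspace _ _ _ _ _ q).
        by apply/set0Pn; exists k; rewrite !inE eqxx.
      by move=> j /Gq; lra.
    exists (k |: F)%SET; split => //; rewrite /l cardsU1 kF add1n.
    have -> : L #|F|.+1 = L #|F| + D + b + c by [].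
    have gF : dot (g F) q <= v.
      by rewrite -subr_ge0 gv sumr_ge0.
    suff : v - D - b <= dot (g (k |: F)%SET) q by lra.
    have /asboolP/Hx[_ xG0 xGs _] := aG.
    rewrite /g dot_suml -[leLHS]mul1r -xGs mulr_suml; apply: ler_sum => j _.
    have [jG|jG] := boolP (j \in (k |: F)%SET); last by rewrite xG0 // !mul0r.
    by rewrite ler_wpM2l ?x_ge0 // Gq.
  rewrite GammaE.
  apply: (@le_trans _ _ (\sum_(F | a F) (softmax_weight a beta (l q) F * (- d0) +
      expR (- kappa) * (d0 + Kb)))).
    apply: ler_sum => F aF; have wF := w_ge0 q F.
    have ek : 0 <= expR (- kappa) * (d0 + Kb).
      by rewrite mulr_ge0 ?expR_ge0 // addr_ge0 // ltW.
    have [kF|kF] := boolP (k \in F).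
      have := ler_wpM2l wF (Hd0 (F, k) aF kF); rewrite /=; lra.
    have := ler_wpM2l wF (gKb F k).
    have := ler_wpM2r (addr_ge0 (ltW d0_gt0) Kb_ge0) (small F aF kF); lra.
  rewrite big_split /= -mulr_suml w_sum mul1r.
  have eM : expR (- kappa) * M <= d0 / 2.
    have e1 : expR (- kappa) * (1 + kappa) <= 1.
      rewrite -[leRHS](expRxMexpNx_1 kappa) mulrC ler_pM2r ?expR_gt0 //.
      exact: expR_ge1Dx.
    have -> : M = kappa * d0 / 2 by rewrite /kappa; field; rewrite gt_eqF.
    have e0 := expR_gt0 (- kappa).
    have : expR (- kappa) * kappa <= 1 by lra.
    rewrite -(ler_pM2r (x := d0 / 2)) ?divr_gt0 //; lra.
  have : \sum_(F | a F) expR (- kappa) * (d0 + Kb) <= expR (- kappa) * M.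
    rewrite /M mulrCA sumr_const -[leLHS]mulr_natl ler_wpM2r //.
      by rewrite mulr_ge0 ?expR_ge0 // addr_ge0 // ltW.
    by rewrite ler_nat max_card.
  lra.
- move=> q i ziq; apply: le_trans (l1 q i ziq) _; apply: softmax_ge => //.
  exact: a1 ziq.
- have [F aF] := a_nonempty.
  apply: le_trans (softmax_ge beta_gt0 a_nonempty (l 0) aF).
  by rewrite /l addr_ge0 // /dot big1 // => j _; rewrite mxE mulr0.
Qed.

(** * The drift of the potential under MaxWeight *)

Lemma capacity_margin (R : realType) (n : nat) (S : set (qvec n)) (rho : R) :
  (convex_hull (@qvec_row R n @` S))° (\row_j rho) ->
  exists2 e : R, 0 < e & forall q s : qvec n,
    (forall s', S s' -> (\sum_j q j * s' j <= \sum_j q j * s j)%N) ->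
    (rho + e) * (\sum_j q j)%:R <= (\sum_j q j * s j)%:R.
Proof.
move=> /nbhs_ballP[e /= e0 ball_hull]; exists (e / 2); first by rewrite divr_gt0.
move=> q s smax.
pose A : set 'rV[R]_n.+1 := [set v | \sum_j (q j)%:R * v 0 j <= (\sum_j q j * s j)%:R].
have hullA : convex_hull (@qvec_row R n @` S) `<=` A.
  apply: smallest_sub.
    move=> u v k; rewrite !inE /A /= => uA vA.
    have -> : \sum_j (q j)%:R * (conv k u v : 'rV_n.+1) 0 j =
        k%:num * (\sum_j (q j)%:R * u 0 j) + (1 - k%:num) * (\sum_j (q j)%:R * v 0 j).
      rewrite !mulr_sumr -big_split; apply: eq_bigr => j _ /=.
      rewrite !mxE /= /unstable.onem; ring.
    have k0 : 0 <= k%:num by [].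
    have k1 : k%:num <= 1 by [].
    nra.
  move=> _ [s' Ss' <-]; rewrite /A /=.
  apply: le_trans (_ : (\sum_j q j * s' j)%:R <= _); last by rewrite ler_nat smax.
  by rewrite natr_sum; apply: ler_sum => j _; rewrite mxE natrM.
have := hullA (\row_j (rho + e / 2)); rewrite /A /=.
under eq_bigr do rewrite mxE mulrC.
rewrite -mulr_sumr -natr_sum; apply; apply: ball_hull.
split=> // i j; rewrite !mxE /ball /= opprD addNKr normrN gtr0_norm ?divr_gt0 //.
by rewrite ltr_pdivrMr // ltr_pMr // ltr1n.
Qed.

Section Mean.
Context d (Omega : measurableType d) (R : realType) (P : probability Omega R).

Definition has_mean (f : Omega -> R) (m : R) :=
  P.-integrable setT (EFin \o f) /\ (\int[P]_w (f w)%:E = m%:E)%E.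

Lemma has_mean_cst c : has_mean (cst c) c.
Proof.
split; first exact: finite_measure_integrable_cst.
transitivity (c%:E * P setT)%E; first by rewrite -(integral_cst P measurableT).
by rewrite -[RHS]mule1; congr (_ * _)%E; exact: probability_setT.
Qed.

Lemma has_meanD f g m k : has_mean f m -> has_mean g k ->
  has_mean (fun w => f w + g w) (m + k).
Proof.
move=> [fi fm] [gi gk]; split.
  by have := integrableD measurableT fi gi; apply: eq_integrable.
rewrite EFinD -fm -gk -(integralD measurableT fi gi).
by apply: eq_integral.
Qed.

Lemma has_meanZ c f m : has_mean f m -> has_mean (fun w => c * f w) (c * m).
Proof.
move=> [fi fm]; split.
  by have := integrableZl measurableT c fi; apply: eq_integrable.
by rewrite EFinM -fm -(integralZl measurableT fi); apply: eq_integral.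
Qed.

Lemma has_mean_sum (I : Type) (r : seq I) (f : I -> Omega -> R) (m : I -> R) :
  (forall i, has_mean (f i) (m i)) ->
  has_mean (fun w => \sum_(i <- r) f i w) (\sum_(i <- r) m i).
Proof.
move=> fm; elim: r => [|i r IHr].
  rewrite big_nil (_ : (fun w => _) = cst 0); first exact: has_mean_cst.
  by apply/funext => w; rewrite big_nil.
rewrite big_cons (_ : (fun w => _) = fun w => f i w + \sum_(i <- r) f i w).
  exact: has_meanD.
by apply/funext => w; rewrite big_cons.
Qed.

Lemma has_mean_indic A : measurable A -> has_mean (\1_A) (fine (P A)).
Proof.
move=> mA; split; first exact: integrable_indic.
by rewrite integral_indic // setIT fineK // fin_num_measure.
Qed.

Lemma le_has_mean f m (g : Omega -> \bar R) : has_mean f m ->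
  measurable_fun setT g -> (forall w, 0 <= g w)%E -> (forall w, g w <= (f w)%:E)%E ->
  (\int[P]_w g w <= m%:E)%E.
Proof.
move=> [fi <-] mg g0 gf; apply: ge0_le_integral => //.
exact: measurable_int fi.
Qed.

Lemma has_mean_excess (X : {RV P >-> nat}) a e : 0 < e ->
  has_mean (fun w => (X w)%:R) a ->
  exists C : nat, exists2 m, m <= e & has_mean (fun w => (X w - C)%:R) m.
Proof.
move=> e0 [Xi Xa].
have mX (g : nat -> R) : measurable_fun setT (fun w => (g (X w))%:E).
  apply/measurable_EFinP; apply: (@measurableT_comp _ _ _ _ _ _ g) => //.
have [] := @dominated_convergence _ _ _ P setT measurableT
  (fun C w => ((X w - C)%:R)%:E) (cst 0%E) (fun w => ((X w)%:R)%:E).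
- by move=> C; apply: (mX (fun k => (k - C)%:R)).
- exact: measurable_cst.
- apply: aeW => w _; apply: cvg_near_cst; exists (X w) => // C /= XC.
  by apply/eqP; rewrite eqe (eqP (_ : X w - C == 0)%N) // subn_eq0.
- exact: Xi.
- by apply: aeW => w C _; rewrite gee0_abs ?lee_fin ?ler_nat ?leq_subr.
move=> _ _; rewrite integral0 => lim0.
have Ci C : P.-integrable setT (fun w => ((X w - C)%:R : R)%:E).
  apply: le_integrable Xi => //; first exact: (mX (fun k => (k - C)%:R)).
  by move=> w _; rewrite !gee0_abs ?lee_fin ?ler_nat ?leq_subr.
have /fine_cvgP[fin] := lim0.
move=> /cvgrPdist_lt /(_ e e0)[C1 _ HC1].
have := HC1 C1 (leqnn C1); rewrite /= sub0r normrN => h.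
exists C1, (fine (\int[P]_w ((X w - C1)%:R : R)%:E)).
  by rewrite ltW // (le_lt_trans (ler_norm _)).
split; first exact: Ci.
by rewrite fineK //; exact: integrable_fin_num.
Qed.

End Mean.

Lemma shift_diff_functional (R : realType) (n : nat) (g v : 'rV[R]_n.+1) :
  dot g (shift_diff v) = \sum_j v 0 j * dot g (shift_diff (delta_mx 0 j)).
Proof.
have D0 : dot g (shift_diff 0) = 0.
  rewrite /dot big1 // => j _; rewrite !mxE subr0; case: eqP => _; exact: mulr0.
rewrite {1}[v]row_sum_delta; elim/big_ind2: _ => // [x a y b xa yb|j _].
  by rewrite shift_diffD dotDr xa yb.
by rewrite shift_diffZ dotZr.
Qed.

Section Drift.
Context (R : realType) (n : nat) (S : set (qvec n)).
Hypotheses (S_finite : finite_set S) (S_closed : schedule_closed S).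
Variables (a p : R).
Hypothesis p_gt0 : 0 < p.
Context (d d' : measure_display) (Omega : measurableType d).
Context (P : probability Omega R) (U : measurableType d').
Variables (arr : nat -> {RV P >-> nat}) (serv : 'I_n.+1 -> nat -> {RV P >-> bool}).
Variables (seed : nat -> {RV P >-> U}) (policy : qvec n -> U -> qvec n).
Hypothesis independence : mutually_independent P (primitive_sigma arr serv seed).
Hypothesis arr_mean : has_mean P (fun w => (arr 0%N w)%:R) a.
Hypothesis serv_law : forall j v, P (serv j v @^-1` [set true]) = p%:E.
Hypothesis policy_measurable : forall q s, measurable [set u | policy q u = s].
Hypothesis policy_maxweight : maxweight S policy.
Variable Q : qvec n -> nat -> Omega -> qvec n.
Hypothesis Q_process : forall x, queueing_process arr serv seed policy (Q x) x.

Let rho := a / p.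
Let weight (q s : qvec n) : R := (\sum_j q j * s j)%N%:R.

Hypothesis chainQ : markov_chain P Q.
Hypothesis capacity : exists2 e : R, 0 < e & forall q s : qvec n,
  (forall s', S s' -> (\sum_j q j * s' j <= \sum_j q j * s j)%N) ->
  (rho + e) * (\sum_j q j)%:R <= weight q s.

Definition effective (q s : qvec n) : qvec n := [ffun j => minn (s j) (q j)].

Definition excess (s : qvec n) : 'rV[R]_n.+1 := \row_j ((s j)%:R - rho).

Lemma dot_excess s q :
  dot (excess s) (qvec_row R q) = weight q s - rho * (\sum_j q j)%:R.
Proof.
rewrite /dot /weight !natr_sum mulr_sumr -sumrB; apply: eq_bigr => j _.
by rewrite !mxE natrM; ring.
Qed.

Definition completed (q : qvec n) (w : Omega) : 'rV[R]_n.+1 :=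
  \row_j (\sum_(v < effective q (policy q (seed 0%N w)) j) serv j v w)%:R.

Lemma one_step_increment q w : qvec_row R (Q q 1%N w) =
  qvec_row R q + (shift_diff (completed q w) + (arr 0%N w)%:R *: delta_mx 0 0).
Proof.
have dep j : departures serv seed policy (Q q) j 1 w =
    (\sum_(v < effective q (policy q (seed 0%N w)) j) serv j v w)%N.
  rewrite /departures /cum_service big_ord1 (queueing_process0 (Q_process q)).
  by rewrite /effective ffunE.
apply/rowP => j; rewrite !mxE.
have := congr1 (fun i : int => i%:~R : R) (Q_process q 1%N w j).
rewrite /= /arrivals /external_arrivals big_ord1 !dep.
by case: (eqVneq j ord0) => [->|j0] /=; rewrite ?intrB ?intrD -!pmulrn => ->; ring.
Qed.

Lemma finite_schedules : exists (N : nat) (s : 'I_N -> qvec n),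
  injective s /\ forall x, S x <-> exists i, s i = x.
Proof.
have /finite_seqP[ss SE] := S_finite.
have us := undup_uniq ss.
exists (size (undup ss)), (fun i => nth [ffun=> 0%N] (undup ss) i); split.
  by move=> i j /eqP; rewrite nth_uniq // => /eqP /val_inj.
move=> x; rewrite SE /=; split.
  rewrite -mem_undup => xs; have lt : (index x (undup ss) < size (undup ss))%N by rewrite index_mem.
  by exists (Ordinal lt); rewrite /= nth_index.
by move=> [i <-]; rewrite -mem_undup mem_nth.
Qed.

Lemma effective_weight (B : nat) (q s : qvec n) : (forall j, (s j <= B)%N) ->
  weight q s - (n.+1 * (B * B))%:R <= weight q (effective q s).
Proof.
move=> sB; rewrite lerBlDr -natrD ler_nat.
have -> : (n.+1 * (B * B) = \sum_(j < n.+1) B * B)%N.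
  by rewrite sum_nat_const card_ord.
rewrite -big_split /=; apply: leq_sum => j _; rewrite ffunE.
have := sB j; case: (leqP (s j) (q j)) => [|qs] sjB; first by rewrite leq_addr.
apply: leq_trans (leq_addl _ _).
by rewrite leq_mul // (leq_trans (ltnW qs)).
Qed.

Lemma has_mean_completed N (s : 'I_N -> qvec n) q (g : 'rV[R]_n.+1) :
  injective s -> (forall x, S x <-> exists i, s i = x) ->
  let pi i := fine (P (seed 0%N @^-1` [set u | policy q u = s i])) in
  \sum_i pi i = 1 /\
  has_mean P (fun w => dot g (shift_diff (completed q w)))
    (\sum_i pi i * (p * dot g (shift_diff (qvec_row R (effective q (s i)))))).
Proof.
move=> s_inj S_s pi.
have chosen w : exists2 i0, policy q (seed 0%N w) = s i0 &
    forall i, i != i0 -> policy q (seed 0%N w) <> s i.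
  have [/S_s[i0 si0] _] := policy_maxweight q (seed 0%N w).
  by exists i0 => // i ii0; rewrite -si0 => /s_inj E; rewrite E eqxx in ii0.
pose A i := seed 0%N @^-1` [set u | policy q u = s i].
pose B j v := serv j v @^-1` [set true].
have mA i : measurable (A i).
  by rewrite -[A i]setTI; exact: (measurable_funP (seed 0%N)).
have mB j v : measurable (B j v).
  by rewrite -[B j v]setTI; exact: (measurable_funP (serv j v)).
have A_chosen w i0 : policy q (seed 0%N w) = s i0 -> \1_(A i0) w = 1 :> R.
  by move=> E; rewrite indicE mem_set.
have A_other w i : policy q (seed 0%N w) <> s i -> \1_(A i) w = 0 :> R.
  by move=> E; rewrite indicE memNset.
split.
  have := @has_mean_sum _ _ _ P _ (index_enum 'I_N) (fun i => \1_(A i)) pi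
    (fun i => has_mean_indic P (mA i)).
  rewrite (_ : (fun w => _) = cst 1).
    move=> [_ E1]; have [_ E2] := has_mean_cst P 1.
    by move: E1; rewrite E2 => -[].
  apply/funext => w; have [i0 Ei0 ne] := chosen w.
  by rewrite (bigD1 i0) //= A_chosen // big1 ?addr0 // => i /ne /A_other.
pose c j := dot g (shift_diff (delta_mx 0 j)).
have AB i j v : fine (P (A i `&` B j v)) = pi i * p.
  have := independence (s := [:: inr 0%N; inl (inr (j, v))])
    (A := fun x => if x is inr _ then A i else B j v) isT.
  rewrite !big_cons big_nil mulr1 serv_law /= => <-.
    congr (fine (P _)); apply/seteqP; split => w /=.
      by move=> [Aw Bw] x; rewrite /= !inE => /orP[/eqP ->|/eqP ->].
    by move=> H; split; [apply: (H (inr 0%N))|apply: (H (inl (inr (j, v))))]; rewrite /= !inE eqxx ?orbT.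
  move=> x; rewrite !inE => /orP[/eqP ->|/eqP ->] /=.
    by exists [set u | policy q u = s i] => //; rewrite setTI.
  by exists [set true] => //; rewrite setTI.
have mean : has_mean P (fun w => \sum_j \sum_i \sum_(v < effective q (s i) j)
    c j * \1_(A i `&` B j v) w)
  (\sum_j \sum_i \sum_(v < effective q (s i) j) c j * (pi i * p)).
  apply: has_mean_sum => j; apply: has_mean_sum => i; apply: has_mean_sum => v.
  apply: has_meanZ; rewrite -(AB i j v); apply: has_mean_indic; exact: measurableI.
rewrite (_ : (fun w => _) = (fun w => \sum_j \sum_i \sum_(v < effective q (s i) j)
    c j * \1_(A i `&` B j v) w)).
  rewrite (_ : \sum_i _ = \sum_j \sum_i \sum_(v < effective q (s i) j) c j * (pi i * p)) //.
  rewrite exchange_big; apply: eq_bigr => i _ /=.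
  rewrite shift_diff_functional mulr_sumr mulr_sumr; apply: eq_bigr => j _.
  rewrite sumr_const card_ord mxE -/(c j) -mulr_natl; ring.
apply/funext => w; rewrite shift_diff_functional; apply: eq_bigr => j _.
have [i0 Ei0 ne] := chosen w.
rewrite mxE -/(c j) Ei0 (bigD1 i0) //= [X in _ = _ + X]big1 ?addr0; last first.
  by move=> i /ne /A_other Ai; rewrite big1 // => v _; rewrite indicI /= Ai mul0r mulr0.
rewrite natr_sum mulr_suml; apply: eq_bigr => v _.
rewrite indicI /= A_chosen // mul1r mulrC; congr (_ * _); rewrite indicE.
case E : (serv j v w); first by rewrite mem_set.
by rewrite memNset // /B /= E.
Qed.

Lemma dot_shift_diff_excess (g : 'rV[R]_n.+1) s :
  p * dot g (shift_diff (excess s)) =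
  p * dot g (shift_diff (qvec_row R s)) + g 0 0 * a.
Proof.
have -> : shift_diff (excess s) = shift_diff (qvec_row R s) + rho *: delta_mx 0 0.
  apply/rowP => j; rewrite !mxE eqxx /=.
  by case: (eqVneq j ord0) => [->|j0] /=; ring.
rewrite dotDr dotZr dot_delta0.
by rewrite /rho; field; rewrite gt_eqF.
Qed.

Lemma small_qvecs (m : nat) : exists C : seq (qvec n),
  forall q, q \notin C -> exists j, (m < q j)%N.
Proof.
exists [seq [ffun j => val (f j)] | f : {ffun 'I_n.+1 -> 'I_m.+1}] => q qC.
apply: contrapT => small; move/negP: qC; apply; apply/mapP.
exists [ffun j => inord (q j)]; first by rewrite mem_enum.
apply/ffunP => j; rewrite !ffunE /= inordK // ltnS leqNgt.
by apply/negP => mq; apply: small; exists j.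
Qed.

Lemma maxweight_drift : exists (V : qvec n -> R) (C : seq (qvec n)) (delta : R),
  [/\ 0 < delta, forall q, 0 <= V q,
    forall q, (transition P Q (EFin \o V) q < +oo)%E &
    forall q, q \notin C -> (transition P Q (EFin \o V) q + delta%:E <= (V q)%:E)%E].
Proof.
have [e e_gt0 margin] := capacity.
have [N [s [s_inj S_s]]] := finite_schedules.
pose z i := excess (s i).
have best q : exists i, (forall j, dot (z j) (qvec_row R q) <= dot (z i) (qvec_row R q)) /\
    e * (\sum_j q j)%:R <= dot (z i) (qvec_row R q).
  have [/S_s[i Ei] imax] := policy_maxweight q point.
  exists i; rewrite /z; split => [j|].
    rewrite !dot_excess lerD2r ler_nat Ei; apply: imax.
    by apply/S_s; exists j.
  rewrite dot_excess; have := margin q (s i); rewrite Ei => /(_ imax); lra.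
pose B := (\sum_i \sum_j s i j)%N.
have sB i j : (s i j <= B)%N.
  by rewrite /B (bigD1 i) //= (bigD1 j) //= -addnA leq_addr.
have z_pos : exists i q, 0 < dot (z i) q.
  have [i [_ ei]] := best [ffun=> 1%N]; exists i, (qvec_row R [ffun=> 1%N]).
  apply: lt_le_trans ei; rewrite mulr_gt0 // ltr0n lt0n sum_nat_eq0 negb_forall.
  by apply/existsP; exists ord0; rewrite ffunE.
pose b : R := (n.+1 * (B * B))%:R.
have [delta [K [delta_gt0 K_gt0 pot]]] := potential_exists z_pos (ler0n _ _ : 0 <= b).
have [L [mL mL_le meanL]] := has_mean_excess
  (divr_gt0 (mulr_gt0 p_gt0 delta_gt0) (mulr_gt0 (ltr0n R 8) K_gt0)) arr_mean.
pose C := (n.+1 * (B + B) + L)%:R : R.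
have [V [Gamma [r [GammaK Vstep Gamma_drift V_ge V0]]]] :=
  pot (p * delta / 4) C (divr_gt0 (mulr_gt0 p_gt0 delta_gt0) (ltr0n R 4)) (ler0n _ _).
have completedB q w j : 0 <= completed q w 0 j <= B%:R.
  rewrite mxE ler0n ler_nat (leq_trans (n := effective q (policy q (seed 0%N w)) j)) //.
    rewrite -[leqRHS]card_ord -sum1_card leq_sum // => v _.
    by case: (serv j v w).
  rewrite ffunE (leq_trans (geq_minl _ _)) //.
  by have [/S_s[i <-] _] := policy_maxweight q (seed 0%N w).
pose G q w := dot (Gamma (qvec_row R q)) (shift_diff (completed q w)) +
  Gamma (qvec_row R q) 0 0 * (arr 0%N w)%:R +
  (V (qvec_row R q) + p * delta / 4 + 2 * K * (arr 0%N w - L)%:R).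
have stepG q w : V (qvec_row R (Q q 1%N w)) <= G q w.
  rewrite one_step_increment.
  set al := arr 0%N w; set x := qvec_row R q; set g := Gamma x.
  have alE : al%:R = (minn al L)%:R + (al - L)%:R :> R by rewrite -natrD minnE subnK ?leq_subr.
  have -> : x + (shift_diff (completed q w) + al%:R *: delta_mx 0 0) =
      x + (shift_diff (completed q w) + (minn al L)%:R *: delta_mx 0 0) +
      (al - L)%:R *: delta_mx 0 0 by rewrite alE scalerDl !addrA.
  apply: le_trans (Vstep _ _ _ _ (ler0n _ _)) _.
    apply: (@le_trans _ _ (\sum_(j < n.+1) ((B + B)%:R +
        (minn al L)%:R * (delta_mx 0 0 : 'rV[R]_n.+1) 0 j))).
      apply: ler_sum => j _; rewrite !mxE.
      apply: le_trans (ler_normD _ _) _; apply: lerD; last first.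
        by rewrite ger0_norm // mulr_ge0.
      apply: le_trans (ler_normB _ _) _; rewrite natrD.
      have nB j' : `|completed q w 0 j'| <= B%:R.
        by have /andP[h0 h1] := completedB q w j'; rewrite ger0_norm.
      have := nB j; rewrite mxE => h1; apply: lerD => //.
      by case: eqP => _; [rewrite normr0 ler0n|have := nB (inord j.-1); rewrite mxE].
    rewrite big_split /= sumr_const card_ord -mulr_sumr.
    rewrite [X in _ * X](bigD1 ord0) //= big1 ?addr0; last first.
      by move=> j j0; rewrite mxE (negbTE j0) andbF.
    by rewrite mxE !eqxx mulr1 /C -mulrnA mulnC natrD lerD // ler_nat geq_minr.
  rewrite /G -/x -/g -/al dotDr dotZr dot_delta0 alE.
  have : - K * (al - L)%:R <= g 0 0 * (al - L)%:R.
    rewrite ler_wpM2r // lerNl; apply: le_trans (ler_norm _) _.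
    by rewrite normrN GammaK.
  lra.
pose pi q i := fine (P (seed 0%N @^-1` [set u | policy q u = s i])).
have meanG q : has_mean P (G q) (\sum_i pi q i *
      (p * dot (Gamma (qvec_row R q)) (shift_diff (qvec_row R (effective q (s i))))) +
    Gamma (qvec_row R q) 0 0 * a + (V (qvec_row R q) + p * delta / 4 + 2 * K * mL)).
  apply: has_meanD.
    apply: has_meanD; last exact: has_meanZ.
    exact: (has_mean_completed _ _ s_inj S_s).2.
  by apply: has_meanD; [exact: has_mean_cst|exact: has_meanZ].
have V_nonneg q : 0 <= V (qvec_row R q).
  have [i [_ ei]] := best q.
  have [q0|q_gt0] := posnP (\sum_j q j)%N; last first.
    have zi : 0 < dot (z i) (qvec_row R q).
      by apply: lt_le_trans ei; rewrite mulr_gt0 // ltr0n.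
    exact: le_trans (ltW zi) (V_ge _ _ zi).
  rewrite (_ : qvec_row R q = 0) //; apply/rowP => j; rewrite !mxE.
  by move/eqP: q0; rewrite sum_nat_eq0 => /forallP/(_ j)/eqP ->.
have transition_le q m : has_mean P (G q) m ->
    (transition P Q (EFin \o (fun q => V (qvec_row R q))) q <= m%:E)%E.
  move=> mean; apply: (le_has_mean mean).
  - exact: (chain_measurable_fun chainQ q 1 (EFin \o (fun q => V (qvec_row R q)))).
  - by move=> w; rewrite lee_fin.
  - by move=> w; rewrite lee_fin.
have [small Hsmall] := small_qvecs (Num.bound (r / e)).
exists (fun q => V (qvec_row R q)), small, (p * delta / 2); split => //.
- by rewrite divr_gt0 ?mulr_gt0.
- by move=> q; apply: le_lt_trans (transition_le q _ (meanG q)) (ltry _).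
move=> q /Hsmall[j0 large].
apply: le_trans (leeD2r _ (transition_le q _ (meanG q))) _.
rewrite -EFinD lee_fin.
have [i [imax ei]] := best q.
have r_le : r <= dot (z i) (qvec_row R q).
  apply: le_trans ei; rewrite -ler_pdivrMl // mulrC.
  apply: (@le_trans _ _ (Num.bound (r / e))%:R).
    apply: le_trans (ler_norm _) _; rewrite ltW //.
    by have := archi_boundP (normr_ge0 (r / e)); rewrite /Num.bound normr_id.
  by rewrite ler_nat (bigD1 j0) //= (leq_trans (ltnW large)) // leq_addr.
set g := Gamma (qvec_row R q).
have drift k : pi q k * (p * dot g (shift_diff (qvec_row R (effective q (s k)))) + g 0 0 * a)
    <= pi q k * (- (p * delta)).
  rewrite -dot_shift_diff_excess.
  have [[u Eu]|none] := pselect (exists u, policy q u = s k); last first.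
    rewrite /pi (_ : _ @^-1` _ = set0) ?measure0 ?mul0r //.
    by apply/seteqP; split => // w /= E; apply: none; exists (seed 0%N w).
  rewrite ler_wpM2l ?fine_ge0 // -mulrN ler_pM2l //.
  have /S_s[k' Ek'] : S (effective q (s k)).
    apply: (S_closed (s := s k)); first by apply/S_s; exists k.
    by move=> j; rewrite ffunE geq_minl.
  rewrite -Ek' -/(z k'); apply: (Gamma_drift _ i _ r_le imax).
  have [_ kmax] := policy_maxweight q u.
  have := effective_weight q (sB k); rewrite -/b.
  have : weight q (s i) <= weight q (s k).
    by rewrite ler_nat -Eu; apply: kmax; apply/S_s; exists i.
  by rewrite /z /= Ek' !dot_excess; lra.
have [pi1 _] := has_mean_completed q g s_inj S_s.
have : \sum_k pi q k * (p * dot g (shift_diff (qvec_row R (effective q (s k)))) + g 0 0 * a)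
    <= - (p * delta).
  apply: le_trans (ler_sum _ (fun k _ => drift k)) _.
  by rewrite -mulr_suml pi1 mul1r.
under eq_bigr do rewrite mulrDr.
rewrite big_split /= -[X in _ + X <= _]mulr_suml pi1 mul1r => total.
have : 2 * K * mL <= p * delta / 4.
  apply: (@le_trans _ _ (2 * K * (p * delta / (8 * K)))).
    by rewrite ler_wpM2l // mulr_ge0 // ltW.
  by rewrite le_eqVlt; apply/orP; left; apply/eqP; field; rewrite gt_eqF.
lra.
Qed.

End Drift.

Theorem theorem3 (R : realType) (n : nat) (S : set (qvec n))
  (S_finite : finite_set S) (S_closed : schedule_closed S)
  (a p : R) (p_gt0 : 0 < p) (p_le1 : p <= 1)
  (d d' : measure_display) (Omega : measurableType d)
  (P : probability Omega R) (U : measurableType d')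
  (arr : nat -> {RV P >-> nat})
  (serv : 'I_n.+1 -> nat -> {RV P >-> bool})
  (seed : nat -> {RV P >-> U})
  (independence : mutually_independent P (primitive_sigma arr serv seed))
  (arr_id : identically_distributed arr)
  (arr_mean : ('E_P[fun w => (arr 0%N w)%:R%R] = a%:E)%E)
  (serv_law : forall j v, P (serv j v @^-1` [set true]) = p%:E)
  (seed_id : identically_distributed seed)
  (policy : qvec n -> U -> qvec n)
  (policy_measurable : forall q s, measurable [set u | policy q u = s])
  (policy_maxweight : maxweight S policy)
  (Q : qvec n -> nat -> Omega -> qvec n)
  (Q_process : forall x, queueing_process arr serv seed policy (Q x) x) :
  capacity_region S (traffic_intensity n a p) ->
  positive_recurrent P Q.
Proof.
move=> /capacity_margin capacity.
have chainQ : markov_chain P Q.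
  exact: (queueing_markov_chain independence arr_id serv_law seed_id policy_measurable).
have arr_has_mean : has_mean P (fun w => (arr 0%N w)%:R) a.
  split; last by rewrite -arr_mean unlock.
  apply/integrableP; split.
    apply/measurable_EFinP.
    by apply: (@measurableT_comp _ _ _ _ _ _ (fun k : nat => k%:R : R)).
  rewrite (eq_integral (fun w => ((arr 0%N w)%:R : R)%:E)); last first.
    by move=> w _; rewrite gee0_abs // lee_fin.
  by move: arr_mean; rewrite unlock => ->; exact: ltry.
have [V [C [delta [delta_gt0 V_ge0 V_fin V_drift]]]] :=
  maxweight_drift S_finite S_closed p_gt0 independence arr_has_mean serv_law
    policy_measurable policy_maxweight Q_process chainQ capacity.
exact: (foster_positive_recurrent chainQ delta_gt0 V_ge0 V_fin V_drift).
Qed.
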